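(* For a positive integer $n$, let $\bar{S}(n)$ denote the number of integers $x$ with $1\le x\le n$ such that $x!$ cannot be written as a sum of three squares of integers. Then for every integer $k\ge 5$, $$ \bar{S}(3\cdot 2^k) = \begin{cases} 3\cdot 2^{k-3} +1, & \text{if } k \equiv 7, 9, 13, 18, 19 \pmod{24},\\ 3\cdot 2^{k-3} + 1- 2^{(k-3)/2}, & \text{if } k \equiv 1, 3, 5 \pmod{24},\\ 3\cdot 2^{k-3} + 1- 2^{(k-2)/2}, & \text{if } k \equiv 0, 4, 10 \pmod{24},\\ 3\cdot 2^{k-3} + 1 - 2^{(k-4)/2}, & \text{if } k \equiv 2, 6, 8, 12 \pmod{24},\\ 3\cdot 2^{k-3} + 1 - 2^{(k-5)/2}, & \text{if } k \equiv 11, 23 \pmod{24},\\ 3\cdot 2^{k-3} + 1 + 2^{(k-4)/2}, & \text{if } k \equiv 14 \pmod{24}, \\ 3\cdot 2^{k-3} + 1 + 2^{(k-1)/2}, & \text{if } k \equiv 15 \pmod{24},\\ 3\cdot 2^{k-3} + 1 + 3\cdot 2^{(k-4)/2}, & \text{if } k \equiv 16 \pmod{24},\\ 3\cdot 2^{k-3} + 1 + 2^{(k-3)/2}, & \text{if } k \equiv 17 \pmod{24},\\ 3\cdot 2^{k-3} + 1 - 3\cdot 2^{(k-4)/2}, & \text{if } k \equiv 20, 22 \pmod{24},\\ 3\cdot 2^{k-3} + 1 - 2^{(k-1)/2}, & \text{if } k \equiv 21 \pmod{24}. \end{cases} $$ *)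

(* Defs.v *)
From mathcomp Require Export all_boot all_order all_algebra.
From mathcomp Require Export boolp.

Set Implicit Arguments.
Unset Strict Implicit.
Unset Printing Implicit Defensive.

Import GRing.Theory.
Local Open Scope ring_scope.

Definition sum_three_squares (m : int) : Prop :=
  exists a b c : int, m = a ^+ 2 + b ^+ 2 + c ^+ 2.

(* The ordinal i : 'I_n stands for the integer x = i + 1, so x runs over 1..n. *)
Definition Sbar (n : nat) : nat :=
  #|[set i : 'I_n | ~~ `[< sum_three_squares (i.+1`!)%:Z >]]|.

(* Main.v *)
Require Import Defs.
From Stdlib Require Import ZArith.
From mathcomp Require Import boolp classical_sets reals exp Rstruct.
From mathcomp Require Import all_boot all_order all_algebra all_solvable all_field.
From mathcomp Require Import zify ring lra.

Set Implicit Arguments.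
Unset Strict Implicit.
Unset Printing Implicit Defensive.

Import Order.TTheory GRing.Theory Num.Theory.
Local Open Scope ring_scope.

(** By the three squares theorem, [x!] is not a sum of three squares exactly
    when its 2-adic valuation is even and its odd part is 7 modulo 8.

    Counting.  From [(2 y + b)! = 2 ^ y * y! * 1 * 3 * 5 * ...] the triple
    (parity of the valuation, odd part mod 8, x mod 4) of [x = 2 y + b] is a
    function of [b] and of the triple of [y].  So the number of [x < 3 * 2 ^ k]
    with a given property of the triple is obtained by iterating a linear map on
    functions of the 32 triples.  The deviation of that iteration from its mean
    is multiplied by [2 ^ 12] every 24 steps.

    Three squares.  A positive integral ternary form of determinant 1 takes only
    sums of three squares as values (Gauss reduction).  For squarefree [n] not
    congruent to 7 modulo 8, such a form with value [n] exists as soon as there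
    is a prime [q = 1 mod 4] with prescribed Legendre symbols [(q / p)] for the
    odd [p] dividing [n] and prescribed [(2 / q)]; quadratic reciprocity shows
    that the conditions on [(-n / q)] and on [(-q / p)] or [(-2 q / p)] are then
    compatible.  As the conditions on [q] involve real characters only, [q]
    is provided by a version of Dirichlet's theorem that needs only the
    non-vanishing of [L(1, chi)] for real [chi], together with Mertens'
    estimate for [\sum chi(d) Lambda(d) / d]. *)

(** * Ternary forms of determinant one *)

Lemma nearest_multiple (a b : int) : 0 < a ->
  exists k : int, - a <= 2 * (b + k * a) <= a.
Proof.
move=> a_gt0; exists (- ((2 * b + a) %/ (2 * a))%Z).
have := divz_eq (2 * b + a) (2 * a).
have a2_neq0 : 2 * a != 0 by lia.
have := modz_ge0 (2 * b + a) a2_neq0.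
have a2_gt0 : 0 < 2 * a by lia.
have := ltz_pmod (2 * b + a) a2_gt0.
by set q := (_ %/ _)%Z; set r := (_ %% _)%Z; lia.
Qed.

(** Lagrange reduction: a translation makes [2 B] at most [A] in size; if then [C < A], exchanging
    the variables with a change of sign keeps the determinant 1 and lowers the leading
    coefficient. *)
Lemma binary_form_reduction (A B C : int) : 0 < A -> 0 < A * C - B ^+ 2 ->
  exists p q r s : int, p * s - q * r = 1 /\
    exists A' B' C' : int,
    [/\ A' = A * p ^+ 2 + 2 * B * p * r + C * r ^+ 2,
        B' = A * p * q + B * (p * s + q * r) + C * r * s,
        C' = A * q ^+ 2 + 2 * B * q * s + C * s ^+ 2 &
        [/\ 0 < A', - A' <= 2 * B' <= A' & A' <= C'] ].
Proof.
have [n] := ubnP `|A|%N; elim: n A B C => // n IHn A B C ltAn A_gt0 D_gt0.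
have [k Hk] := nearest_multiple B A_gt0.
pose B1 := B + k * A; pose C1 := C + 2 * B * k + A * k ^+ 2.
have D1 : A * C1 - B1 ^+ 2 = A * C - B ^+ 2 by rewrite /C1 /B1; ring.
have C1_gt0 : 0 < C1.
  rewrite -(pmulr_rgt0 _ A_gt0); apply: (lt_le_trans D_gt0).
  by rewrite -D1 gerBl sqr_ge0.
have [leAC|ltCA] := lerP A C1.
  exists 1, k, 0, 1; split; first by ring.
  by exists A, B1, C1; split => //; rewrite /B1 /C1; ring.
have [||p [q [r [s [Edet [A' [B' [C' [EA EB EC Hred]]]]]]]]] :=
    IHn C1 (- B1) A _ C1_gt0; first by lia.
  by rewrite sqrrN mulrC D1.
exists (k * p - r), (k * q - s), p, q; split; first by rewrite -Edet; ring.
by exists A', B', C'; split; rewrite // ?EA ?EB ?EC /C1 /B1; ring.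
Qed.

Lemma reduced_form_bound (A B C D : int) :
    0 < A -> - A <= 2 * B <= A -> A <= C -> A * C - B ^+ 2 = D ->
  3 * A ^+ 2 <= 4 * D.
Proof.
move=> A_gt0 HB HC ED.
have : 0 <= (A - 2 * B) * (A + 2 * B) by apply: mulr_ge0; lia.
have : A * A <= A * C by rewrite ler_pM2l.
by rewrite -ED; lia.
Qed.

Definition ternary_form (a b c d e g x y z : int) : int :=
  a * x ^+ 2 + b * y ^+ 2 + c * z ^+ 2
  + 2 * d * y * z + 2 * e * x * z + 2 * g * x * y.

Definition ternary_det (a b c d e g : int) : int :=
  a * b * c + 2 * d * e * g - a * d ^+ 2 - b * e ^+ 2 - c * g ^+ 2.

(** Descent on [a]. Multiplying the form by [a] and removing the square of [a x + g y + e z] leaves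
    a binary form in [y], [z] of determinant [a]. Reducing it and shifting [x] either yields a
    smaller diagonal coefficient, which is moved to the front, or forces the form to be a visible
    sum of three squares. *)
Lemma ternary_det1_sum3 (a b c d e g x y z : int) :
    0 < a -> 0 < a * b - g ^+ 2 -> ternary_det a b c d e g = 1 ->
  sum_three_squares (ternary_form a b c d e g x y z).
Proof.
have [n] := ubnP `|a|%N.
elim: n a b c d e g x y z => // n IHn a b c d e g x y z ltan a_gt0 A_gt0 D1.
have EBin : (a * b - g ^+ 2) * (a * c - e ^+ 2) - (a * d - g * e) ^+ 2 = a.
  by rewrite -[RHS]mulr1 -D1 /ternary_det; ring.
have EBin_gt0 : 0 < (a * b - g ^+ 2) * (a * c - e ^+ 2) - (a * d - g * e) ^+ 2.
  by rewrite EBin.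
have [p [q [r [s [Edet [A' [B' [C' [EA EB EC [A'_gt0 HB HAC]]]]]]]]]] :=
  binary_form_reduction A_gt0 EBin_gt0.
pose b1 := b * p ^+ 2 + 2 * d * p * r + c * r ^+ 2.
pose c1 := b * q ^+ 2 + 2 * d * q * s + c * s ^+ 2.
pose d1 := b * p * q + d * (p * s + q * r) + c * r * s.
pose g1 := g * p + e * r; pose e1 := g * q + e * s.
pose y1 := s * y - q * z; pose z1 := p * z - r * y.
have Ey : y = p * y1 + q * z1.
  by rewrite -[LHS]mul1r -Edet /y1 /z1; ring.
have Ez : z = r * y1 + s * z1.
  by rewrite -[LHS]mul1r -Edet /y1 /z1; ring.
have Edet' : A' * C' - B' ^+ 2 = a.
  by rewrite -EBin -[RHS]mulr1 -[1 in RHS](expr1n _ 2) -Edet EA EB EC; ring.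
have [k Hk] := nearest_multiple g1 a_gt0.
pose g2 := g1 + k * a; pose b2 := b1 + 2 * g1 * k + a * k ^+ 2.
pose d2 := d1 + k * e1; pose x1 := x - k * y1.
have EA2 : A' = a * b2 - g2 ^+ 2.
  by rewrite EA /b2 /g2 /b1 /g1; ring.
have ED2 : ternary_det a b2 c1 d2 e1 g2 = 1.
  rewrite -D1 -[RHS]mulr1 -[1 in RHS](expr1n _ 2) -Edet.
  by rewrite /ternary_det /b2 /g2 /d2 /b1 /c1 /d1 /e1 /g1; ring.
have EF : ternary_form a b c d e g x y z =
          ternary_form b2 a c1 e1 d2 g2 y1 x1 z1.
  rewrite Ey Ez /x1 /ternary_form /b2 /d2 /g2 /b1 /c1 /d1 /e1 /g1.
  by clearbody y1 z1; ring.
have HA : 3 * A' ^+ 2 <= 4 * a by apply: (reduced_form_bound A'_gt0 HB HAC).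
have Eg2 : - a <= 2 * g2 <= a by [].
have Ed2 : B' = a * d2 - g2 * e1 by rewrite EB /d2 /g2 /d1 /e1 /g1; ring.
have Ec1 : C' = a * c1 - e1 ^+ 2 by rewrite EC /c1 /e1; ring.
clearbody b2 c1 d2 e1 g2 x1 y1 z1.
clear b1 d1 g1 Ey Ez Hk k EA EB EC EBin EBin_gt0 Edet p q r s A_gt0 D1.
have [ltba|leab] := ltrP b2 a.
  rewrite EF; apply: IHn.
  - have b2_gt0 : 0 < b2.
      rewrite -(pmulr_rgt0 _ a_gt0); have := sqr_ge0 g2; lia.
    by lia.
  - by rewrite -(pmulr_rgt0 _ a_gt0); have := sqr_ge0 g2; lia.
  - by rewrite mulrC -EA2.
  by rewrite -ED2 /ternary_det; ring.
have Hg : 4 * g2 ^+ 2 <= a ^+ 2.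
  have : 0 <= (a - 2 * g2) * (a + 2 * g2) by apply: mulr_ge0; lia.
  by lia.
have HaA : 3 * a ^+ 2 <= 4 * A'.
  have : a * a <= a * b2 by rewrite ler_pM2l.
  by lia.
(* The bounds [3 a ^ 2 <= 4 A'] and [3 A' ^ 2 <= 4 a] together give [27 a ^ 3 <= 64], which excludes
   [a >= 2]. *)
have a1 : a = 1.
  have : 27 * a ^+ 3 <= 64.
    have a2_ge0 := sqr_ge0 a.
    have H : (3 * a ^+ 2) * (3 * a ^+ 2) <= (4 * A') * (4 * A').
      by apply: ler_pM => //; lia.
    have : 27 * a ^+ 3 * a <= 64 * a by lia.
    by rewrite ler_pM2r.
  have [//|a_ge2] : a = 1 \/ 2 <= a by lia.
  have : 2 ^+ 3 <= a ^+ 3 by rewrite lerXn2r ?nnegrE //; lia.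
  by lia.
have A1 : A' = 1.
  have [//|A_ge2] : A' = 1 \/ 2 <= A' by lia.
  have : 2 ^+ 2 <= A' ^+ 2 by rewrite lerXn2r ?nnegrE //; lia.
  by lia.
have g20 : g2 = 0 by lia.
have B0 : B' = 0 by lia.
have C1 : C' = 1 by move: Edet'; rewrite A1 B0; lia.
have b21 : b2 = 1 by move: EA2; rewrite A1 a1 g20; lia.
exists (x1 + e1 * z1), y1, z1.
rewrite EF /ternary_form b21 a1 g20.
have -> : d2 = 0 by move: Ed2; rewrite B0 a1 g20; lia.
have -> : c1 = 1 + e1 ^+ 2 by move: Ec1; rewrite C1 a1; lia.
by ring.
Qed.

(* The form [((s (m x + b y) + n z) ^+ 2 + m x ^+ 2 + 2 b x y + h y ^+ 2) / n]
   has integral coefficients and determinant [1], and its value at (0, 0, 1)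
   is [n]. *)
Lemma sum3_of_residues (n m b h s w : int) : 0 < n -> 0 < m ->
  b ^+ 2 + n = m * h -> s ^+ 2 * m + 1 = w * n -> sum_three_squares n.
Proof.
move=> n_gt0 m_gt0 Eb Es.
have w_gt0 : 0 < w.
  by rewrite -(pmulr_lgt0 _ n_gt0) -Es ltr_wpDl // mulr_ge0 ?sqr_ge0 // ltW.
have En : n = m * h - b ^+ 2 by rewrite -Eb; ring.
have E1 : w * n - s ^+ 2 * m = 1 by rewrite -Es; ring.
have Emin : m * w * (h * w - s ^+ 2) - (b * w) ^+ 2 = w.
  by rewrite -[RHS]mulr1 -E1 En; ring.
have := @ternary_det1_sum3 (m * w) (h * w - s ^+ 2) n (s * b) (s * m) (b * w)
  0 0 1 (mulr_gt0 m_gt0 w_gt0).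
rewrite Emin => /(_ w_gt0).
have -> : ternary_det (m * w) (h * w - s ^+ 2) n (s * b) (s * m) (b * w) = 1.
  transitivity ((w * n - s ^+ 2 * m) ^+ 2).
    by rewrite /ternary_det En; ring.
  by rewrite E1 expr1n.
have -> : ternary_form (m * w) (h * w - s ^+ 2) n (s * b) (s * m) (b * w) 0 0 1
          = n by rewrite /ternary_form; ring.
exact.
Qed.

(** * Finite sums and divisor sums *)

Section FiniteSums.
Variable R : realFieldType.
Implicit Types f w : nat -> R.

Lemma summation_by_parts f w a b : (a <= b)%N ->
  \sum_(a <= n < b) f n * w n =
  (\sum_(a <= n < b) f n) * w b +
  \sum_(a <= n < b) (\sum_(a <= i < n.+1) f i) * (w n - w n.+1).
Proof.
move=> /subnKC <-; elim: (b - a)%N => [|k IHk].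
  by rewrite addn0 !big_geq // mul0r addr0.
rewrite addnS !(@big_nat_recr _ _ _ (a + k) a) ?leq_addr //= IHk.
by ring.
Qed.

Lemma abel_bound f w (C : R) a b :
    (forall n, `|\sum_(a <= i < n) f i| <= C) ->
    (forall n, (a <= n)%N -> 0 <= w n) ->
    (forall n, (a <= n)%N -> w n.+1 <= w n) ->
  `|\sum_(a <= n < b) f n * w n| <= C * w a.
Proof.
move=> HC w_ge0 w_dec.
have C_ge0 : 0 <= C by apply: le_trans (HC 0%N).
have [ltba|leab] := ltnP b a.
  by rewrite big_geq ?normr0 ?mulr_ge0 ?w_ge0 // ltnW.
rewrite summation_by_parts //; apply: le_trans (ler_normD _ _) _.
have -> : C * w a = C * w b + \sum_(a <= n < b) C * (w n - w n.+1).
  rewrite -mulr_sumr -mulrDr; congr (_ * _).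
  have -> : \sum_(a <= n < b) (w n - w n.+1) =
            - \sum_(a <= n < b) (w n.+1 - w n).
    by rewrite -sumrN; apply: eq_bigr => i _; rewrite opprB.
  by rewrite telescope_sumr //; ring.
apply: lerD; first by rewrite normrM (ger0_norm (w_ge0 _ leab)) ler_wpM2r ?w_ge0.
apply: le_trans (ler_norm_sum _ _ _) _.
apply: ler_sum_nat => n /andP[lean _].
by rewrite normrM [`|w n - _|]ger0_norm ?subr_ge0 ?w_dec // ler_wpM2r ?subr_ge0 ?w_dec.
Qed.

Lemma sum_multiples (V : nmodType) (G : nat -> V) d X : (0 < d)%N ->
  \sum_(1 <= n < X.+1 | (d %| n)%N) G (n %/ d)%N =
  \sum_(1 <= m < (X %/ d).+1) G m.
Proof.
move=> d_gt0; elim: X => [|X IHX]; first by rewrite div0n !big_geq.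
rewrite big_mkcond big_nat_recr //= -big_mkcond /= IHX divnS //.
case: (boolP (d %| X.+1)%N) => _; rewrite ?add0n ?addr0 //= add1n.
by rewrite [RHS]big_nat_recr.
Qed.

Lemma sum_divisorsE (V : nmodType) (F : nat -> V) n X : (0 < n <= X)%N ->
  \sum_(d <- divisors n) F d = \sum_(1 <= d < X.+1 | (d %| n)%N) F d.
Proof.
case/andP=> n_gt0 lenX; rewrite -[RHS]big_filter; apply: perm_big.
apply: uniq_perm; rewrite ?divisors_uniq ?filter_uniq ?iota_uniq // => d.
rewrite -dvdn_divisors // mem_filter mem_index_iota.
case: (boolP (d %| n)%N) => // dvd.
by rewrite (dvdn_gt0 n_gt0) // ltnS (leq_trans (dvdn_leq n_gt0 dvd)).
Qed.

Lemma sum_dirichlet_convolution (V : nmodType) (F : nat -> nat -> V) X :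
  \sum_(1 <= n < X.+1) \sum_(d <- divisors n) F d (n %/ d)%N =
  \sum_(1 <= d < X.+1) \sum_(1 <= m < (X %/ d).+1) F d m.
Proof.
under eq_big_nat => n Hn do rewrite (sum_divisorsE _ Hn).
rewrite (exchange_big_dep xpredT) //=; apply: eq_big_nat => d /andP[d_gt0 _].
by rewrite -sum_multiples.
Qed.

Lemma ler_sum_subseq (T : eqType) (s t : seq T) (F : T -> R) :
    uniq s -> uniq t -> {subset s <= t} -> (forall i, 0 <= F i) ->
  \sum_(i <- s) F i <= \sum_(i <- t) F i.
Proof.
move=> us ut sst F_ge0; rewrite [leRHS](bigID [in s]) /=.
rewrite -[X in _ <= X + _]big_filter [X in _ <= X + _](perm_big s).
  by rewrite lerDl sumr_ge0.
apply: uniq_perm; rewrite ?filter_uniq // => x; rewrite mem_filter.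
by case: (boolP (x \in s)) => //= /sst ->.
Qed.

End FiniteSums.

(** * Divisor sums of a real character *)

Section DivisorSum.
Variables (R : realFieldType) (chi : nat -> R).
Hypothesis chiM : forall m n, chi (m * n)%N = chi m * chi n.
Hypothesis chi1 : chi 1%N = 1.
Hypothesis chi_val : forall n, [\/ chi n = 0, chi n = 1 | chi n = -1].

Let r n := \sum_(d <- divisors n) chi d.

(** The divisors of [p n] prime to [p] are the divisors of the [p']-part of [n]; the others are [p]
    times a divisor of [n]. *)
Lemma divisor_sum_prime_mul p n : prime p -> (0 < n)%N ->
  r (p * n) = r (n`_p^')%N + chi p * r n.
Proof.
move=> p_pr n_gt0; have p_gt0 := prime_gt0 p_pr.
have m_gt0 : (0 < n`_p^')%N by rewrite part_gt0.
rewrite /r mulr_sumr; under [X in _ + X]eq_bigr do rewrite -chiM.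
rewrite -(big_map (muln p) xpredT) -big_cat; apply: perm_big.
have inj_p : injective (muln p).
  by move=> a b /eqP; rewrite eqn_pmul2l // => /eqP.
apply: uniq_perm; first exact: divisors_uniq.
  rewrite cat_uniq map_inj_uniq // !divisors_uniq /= andbT.
  apply/hasPn => _ /mapP[d _ ->]; rewrite -dvdn_divisors //.
  apply: contraL (part_pnat p^' n) => dvd.
  apply/negP => pn; have := pnat_dvd (dvdn_trans (dvdn_mulr d (dvdnn p)) dvd) pn.
  by rewrite pnatE // inE /= inE eqxx.
move=> d; rewrite mem_cat -!dvdn_divisors ?muln_gt0 ?p_gt0 //.
have [/dvdnP[e ->]|pNd] := boolP (p %| d)%N.
  rewrite (mulnC e) dvdn_pmul2l // mem_map // -dvdn_divisors //.
  case: (boolP (e %| n)%N) => [|_]; first by rewrite orbT.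
  rewrite orbF; apply/esym/negP => dvd.
  have := pnat_dvd (dvdn_trans (dvdn_mulr e (dvdnn p)) dvd) (part_pnat p^' n).
  by rewrite pnatE // inE /= inE eqxx.
have -> : (d \in [seq (p * i)%N | i <- divisors n]) = false.
  by apply/negP => /mapP[i _ Ed]; rewrite Ed dvdn_mulr in pNd.
have cop : coprime d p by rewrite coprime_sym prime_coprime.
rewrite orbF Gauss_dvdr // -{1}(partnC p n_gt0) Gauss_dvdr //.
by rewrite p_part coprimeXr.
Qed.

(** Induction on [n], splitting off its least prime [p]. Only [chi p = -1] involves a subtraction,
    and there two factors [p] are removed at once. *)
Lemma divisor_sum_ge0_sqr n : (0 < n)%N ->
  0 <= r n /\ ((exists m, n = m ^ 2)%N -> 1 <= r n).
Proof.
have [k] := ubnP n; elim: k n => // k IHk n ltnk n_gt0.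
have [n_le1|n_gt1] := leqP n 1.
  have -> : n = 1%N by apply/eqP; rewrite eqn_leq n_le1.
  by rewrite /r [divisors 1]/= big_seq1 chi1 ler01.
have p_pr := pdiv_prime n_gt1; set p := pdiv n in p_pr.
have p_gt0 := prime_gt0 p_pr; have p_gt1 := prime_gt1 p_pr.
have [n1 En] := dvdnP (pdiv_dvd n); rewrite mulnC -/p in En.
have n1_gt0 : (0 < n1)%N by move: n_gt0; rewrite En muln_gt0 => /andP[].
have ltn1 : (n1 < k)%N by apply: leq_trans (ltnSE ltnk); rewrite En ltn_Pmull.
have m_gt0 : (0 < n1`_p^')%N by rewrite part_gt0.
have ltm : (n1`_p^' < k)%N.
  by rewrite (leq_ltn_trans _ ltn1) // dvdn_leq // dvdn_part.
have [r1_ge0 _] := IHk _ ltn1 n1_gt0.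
have [rm_ge0 rm_sqr] := IHk _ ltm m_gt0.
have Er := divisor_sum_prime_mul p_pr n1_gt0; rewrite -En in Er.
have sqr_part : (exists m, n = m ^ 2)%N -> (exists m, n1`_p^' = m ^ 2)%N.
  case=> m Em; exists (m`_p^')%N.
  have -> : (n1`_p^' = n`_p^')%N.
    by rewrite En partnM // [(p`_ _)%N]part_p'nat ?mul1n // pnatNK pnat_id.
  by rewrite Em partnX.
case: (chi_val p) => chip; rewrite Er chip.
- by rewrite mul0r addr0; split=> // /sqr_part.
- rewrite mul1r; split; first exact: addr_ge0.
  by move=> /sqr_part/rm_sqr H; rewrite (le_trans H) // lerDl.
(* If [p] divides [n1], using the recursion twice cancels the [p']-parts and leaves the value at
   [n / p ^ 2]; otherwise the value is 0 and [n], divisible by [p] exactly once, is not a square. *)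
rewrite mulN1r; have [pn1|pNn1] := boolP (p %| n1)%N.
  have [n2 En1] := dvdnP pn1; rewrite mulnC in En1.
  have n2_gt0 : (0 < n2)%N by move: n1_gt0; rewrite En1 muln_gt0 => /andP[].
  have ltn2 : (n2 < k)%N by apply: leq_trans (ltnW ltn1); rewrite En1 ltn_Pmull.
  have := divisor_sum_prime_mul p_pr n2_gt0; rewrite -En1 chip => ->.
  have -> : (n1`_p^' = n2`_p^')%N.
    by rewrite En1 partnM // [(p`_ _)%N]part_p'nat ?mul1n // pnatNK pnat_id.
  have -> : r (n2`_p^')%N - (r (n2`_p^')%N + -1 * r n2) = r n2 by ring.
  have [r2_ge0 r2_sqr] := IHk _ ltn2 n2_gt0; split=> // -[m Em]; apply: r2_sqr.
  have /dvdnP[m1 Em1] : (p %| m)%N.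
    have : (p %| m ^ 2)%N by rewrite -Em En dvdn_mulr.
    by rewrite Euclid_dvdX // => /andP[].
  exists m1; apply/eqP; rewrite -(eqn_pmul2l p_gt0) -(eqn_pmul2l p_gt0).
  by rewrite -En1 -En Em Em1 expnMn mulnC -mulnA.
have -> : (n1`_p^' = n1)%N.
  by apply: part_pnat_id; rewrite p'natE.
rewrite subrr; split=> // -[m Em].
have /dvdnP[m1 Em1] : (p %| m)%N.
  have : (p %| m ^ 2)%N by rewrite -Em En dvdn_mulr.
  by rewrite Euclid_dvdX // => /andP[].
case/negP: pNn1; rewrite -(@dvdn_pmul2l p) // -En Em Em1 expnMn.
by rewrite dvdn_mull.
Qed.

Lemma divisor_sum_ge0 n : 0 <= r n.
Proof.
have [->|n_gt0] := posnP n; first by rewrite /r [divisors 0]/= big_seq1 chi1.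
by have [] := divisor_sum_ge0_sqr n_gt0.
Qed.

Lemma divisor_sum_sqr_ge1 m : (0 < m)%N -> 1 <= r (m ^ 2)%N.
Proof.
move=> m_gt0; have m2_gt0 : (0 < m ^ 2)%N by rewrite expn_gt0 m_gt0.
by have [_] := divisor_sum_ge0_sqr m2_gt0; apply; exists m.
Qed.

End DivisorSum.

(** * Non-vanishing of L(1, chi) for real characters *)

Section NonVanishing.
Variables (R : realType) (chi : nat -> R) (C : R).
Hypothesis chiM : forall m n, chi (m * n)%N = chi m * chi n.
Hypothesis chi1 : chi 1%N = 1.
Hypothesis chi_val : forall n, [\/ chi n = 0, chi n = 1 | chi n = -1].
Hypothesis chi_sum : forall a b, `|\sum_(a <= n < b) chi n| <= C.

Let C_ge0 : 0 <= C.
Proof. exact: le_trans (chi_sum 0 0). Qed.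

Lemma norm_chi_le1 n : `|chi n| <= 1.
Proof. by case: (chi_val n) => ->; rewrite ?normrN ?normr0 ?normr1. Qed.

Let s y := \sum_(1 <= n < y.+1) chi n * n%:R^-1.

Lemma partial_L_cauchy y z : (y <= z)%N -> `|s z - s y| <= C * y.+1%:R^-1.
Proof.
move=> leyz; rewrite /s (@big_cat_nat _ _ _ y.+1 1 z.+1) //= addrAC subrr add0r.
apply: (@abel_bound R chi (fun n => n%:R^-1)) => // n len.
  by rewrite invr_ge0.
by rewrite lef_pV2 ?posrE ?ltr0n ?ler_nat // (leq_trans _ len).
Qed.

(** [L] is the supremum of the lower ends of the intervals of radius [C / (y + 1)] about [s y]; by
    the Cauchy estimate every upper end bounds every lower end. *)
Lemma partial_L_lim : exists L, forall y, `|s y - L| <= C * y.+1%:R^-1.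
Proof.
pose E : set R := [set x | exists y, x = s y - C * y.+1%:R^-1]%classic.
have ubE y : ubound E (s y + C * y.+1%:R^-1).
  move=> _ [z ->]; have y1 : 0 <= C * y.+1%:R^-1 by rewrite mulr_ge0 ?invr_ge0.
  have z1 : 0 <= C * z.+1%:R^-1 by rewrite mulr_ge0 ?invr_ge0.
  have aux (a b c d : R) : 0 <= c -> 0 <= d ->
      `|a - b| <= c \/ `|a - b| <= d -> a - d <= b + c.
    by move=> c0 d0; rewrite !ler_norml => -[] /andP[]; lra.
  apply: aux => //; have [/partial_L_cauchy|/ltnW/partial_L_cauchy] := leqP y z.
    by left.
  by rewrite distrC; right.
exists (sup E) => y; rewrite ler_norml; apply/andP; split.
  have : sup E <= s y + C * y.+1%:R^-1.
    by apply: ge_sup; [exists (s 0%N - C * 1%:R^-1), 0%N | exact: ubE].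
  by move=> H; rewrite lerBrDr [leLHS]addrC lerBlDr.
have : s y - C * y.+1%:R^-1 <= sup E.
  by apply: ub_le_sup; [exists (s 0%N + C * 1%:R^-1); exact: ubE | exists y].
by move=> H; rewrite lerBlDr [leRHS]addrC -lerBlDr.
Qed.

(** The multiples of [d] up to [X], counted with a linear weight; it makes the error relative to
    [X ^ 2 / (2 d) - X / 2] at most [d], whatever [X] is. *)
Let G X d : R := \sum_(1 <= m < (X %/ d).+1) (X%:R - d%:R * m%:R).

Lemma sum_first_nat N : \sum_(1 <= m < N.+1) m%:R = N%:R * N.+1%:R / 2 :> R.
Proof.
elim: N => [|N IHN]; first by rewrite big_geq // !mul0r.
by rewrite big_nat_recr //= IHN; field.
Qed.

Lemma fejer_sumE X d : (0 < d)%N ->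
  G X d = X%:R ^+ 2 / (2 * d%:R) - X%:R / 2
          + (X %% d)%:R * (d%:R - (X %% d)%:R) / (2 * d%:R).
Proof.
move=> d_gt0; rewrite /G sumrB -mulr_sumr sum_first_nat.
rewrite sumr_const_nat subn1 /= -mulr_natr.
have dn0 : d%:R != 0 :> R by rewrite pnatr_eq0 -lt0n.
set q := (X %/ d)%N; set rho := (X %% d)%N.
have -> : X%:R = q%:R * d%:R + rho%:R :> R by rewrite -natrM -natrD -divn_eq.
by rewrite -(natr1 q); field.
Qed.

Lemma fejer_sum_ge0 X d : 0 <= G X d.
Proof.
rewrite /G big_nat; apply: sumr_ge0 => m /andP[_ lem].
rewrite subr_ge0 -natrM ler_nat mulnC; apply: leq_trans (leq_trunc_div X d).
by rewrite leq_mul2r orbC -ltnS lem.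
Qed.

Lemma fejer_sum_decr X d : (0 < d)%N -> G X d.+1 <= G X d.
Proof.
move=> d_gt0; have led : (X %/ d.+1 <= X %/ d)%N by rewrite leq_div2l.
rewrite /G (@big_cat_nat _ _ _ (X %/ d.+1).+1 1 (X %/ d).+1) //=.
rewrite -[leLHS]addr0; apply: lerD.
  by apply: ler_sum => m _; rewrite lerB // ler_wpM2r // ler_nat.
rewrite big_nat; apply: sumr_ge0 => m /andP[_ lem].
rewrite subr_ge0 -natrM ler_nat mulnC; apply: leq_trans (leq_trunc_div X d).
by rewrite leq_mul2r orbC -ltnS lem.
Qed.

Lemma fejer_sum_le X d : (0 < d <= X)%N -> G X d <= X%:R ^+ 2 / (2 * d%:R).
Proof.
case/andP=> d_gt0 ledX; rewrite fejer_sumE //.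
have d0 : 0 < d%:R :> R by rewrite ltr0n.
have ltr : (X %% d)%:R <= d%:R :> R by rewrite ler_nat ltnW // ltn_pmod.
have r0 : 0 <= (X %% d)%:R :> R by [].
have dX : d%:R <= X%:R :> R by rewrite ler_nat.
have : (X %% d)%:R * (d%:R - (X %% d)%:R) / (2 * d%:R) <= X%:R / 2 :> R.
  rewrite ler_pdivrMr ?mulr_gt0 //.
  have -> : X%:R / 2 * (2 * d%:R) = X%:R * d%:R :> R by field.
  by apply: ler_pM; lra.
by lra.
Qed.

Lemma weighted_divisor_sumE X :
  \sum_(1 <= n < X.+1) (\sum_(d <- divisors n) chi d) * (X%:R - n%:R) =
  \sum_(1 <= d < X.+1) chi d * G X d.
Proof.
transitivity (\sum_(1 <= n < X.+1) \sum_(d <- divisors n)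
                chi d * (X%:R - d%:R * (n %/ d)%:R)).
  apply: eq_big_nat => n /andP[n_gt0 _]; rewrite mulr_suml.
  rewrite big_seq [RHS]big_seq; apply: eq_bigr => d.
  rewrite -dvdn_divisors // => dvd; congr (_ * (_ - _)).
  by rewrite -natrM mulnC divnK.
rewrite (sum_dirichlet_convolution (fun d m => chi d * (X%:R - d%:R * m%:R))).
by apply: eq_bigr => d _; rewrite mulr_sumr.
Qed.

(** Only the squares [n = m ^ 2] are kept: there the divisor sum is at least 1, and elsewhere it is
    nonnegative. *)
Lemma weighted_divisor_sum_ge M : (4 <= M)%N ->
  M%:R ^+ 3 / 2 <=
  \sum_(1 <= n < (M ^ 2).+1) (\sum_(d <- divisors n) chi d) * ((M ^ 2)%:R - n%:R).
Proof.
move=> M_ge4.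
(* The indicator keeps [F] nonnegative beyond [M ^ 2], as the comparison of sums asks for
   nonnegativity everywhere. *)
pose F n := (\sum_(d <- divisors n) chi d) * ((M ^ 2)%:R - n%:R) *
             (n <= M ^ 2)%N%:R.
have F_ge0 n : 0 <= F n.
  rewrite /F; case: leqP => [le|_]; last by rewrite mulr0.
  by rewrite mulr1 mulr_ge0 ?divisor_sum_ge0 // subr_ge0 ler_nat.
have -> : \sum_(1 <= n < (M ^ 2).+1)
      (\sum_(d <- divisors n) chi d) * ((M ^ 2)%:R - n%:R) =
    \sum_(1 <= n < (M ^ 2).+1) F n.
  by apply: eq_big_nat => n /andP[_]; rewrite ltnS /F => ->; rewrite mulr1.
have inj2 : injective (fun m => m ^ 2)%N.
  by move=> a b /eqP; rewrite eqn_exp2r // => /eqP.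
apply: (@le_trans _ _ (\sum_(n <- [seq (m ^ 2)%N | m <- index_iota 1 M.+1]) F n));
  last first.
  apply: ler_sum_subseq => //; rewrite ?map_inj_uniq ?iota_uniq //.
  move=> n /mapP[m]; rewrite !mem_index_iota !ltnS => /andP[m0 lemM] ->.
  by rewrite expn_gt0 m0 leq_exp2r.
rewrite big_map.
apply: (@le_trans _ _ (\sum_(1 <= m < M.+1) (M%:R ^+ 2 - m%:R ^+ 2))).
  have -> : forall N, \sum_(1 <= m < N.+1) (M%:R ^+ 2 - m%:R ^+ 2) =
     N%:R * M%:R ^+ 2 - N%:R * N.+1%:R * (2 * N%:R + 1) / 6 :> R.
    elim=> [|N IHN]; first by rewrite big_geq // !mul0r subrr.
    by rewrite big_nat_recr //= IHN; field.
  have M4 : 4 <= M%:R :> R by rewrite ler_nat.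
  have : 0 <= M%:R * (M%:R - 4) * (M%:R + 1) :> R.
    by rewrite !mulr_ge0 //; lra.
  by rewrite -natr1; lra.
apply: ler_sum_nat => m /andP[m0]; rewrite ltnS => le.
rewrite /F leq_exp2r // le mulr1 !natrX.
rewrite ler_peMl ?divisor_sum_sqr_ge1 // subr_ge0.
by rewrite lerXn2r ?nnegrE ?ler_nat.
Qed.

(* With [X = T ^ 6], the sum of [r n * (X - n)], where [r] is the convolution of
   [1] and [chi], is at least [T ^ 9 / 2] because [r] is nonnegative and at least
   [1] on squares; if [L] were [0], the expansion of [G X d] for [d <= T ^ 4] and
   Abel summation for larger [d] would bound it by a multiple of [T ^ 8]. *)
Lemma L_neq0 L : (forall y, `|s y - L| <= C * y.+1%:R^-1) -> L != 0.
Proof.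
move=> HL; apply/eqP => L0.
(* The estimates below add up to at most [(3 C / 2 + 1) T ^ 8]; this choice makes that less than
   [T ^ 9 / 2] and ensures [T >= 4]. *)
have [T T_gt] : exists T : nat, 4 * C + 4 < T%:R.
  by exists (Num.truncn (4 * C + 4)).+1; apply: truncnS_gt.
have T4r : 4 <= T%:R :> R by have C0 := C_ge0; lra.
have T4 : (4 <= T)%N by rewrite -(ler_nat R).
have T_gt0 : 0 < T%:R :> R by rewrite ltr0n (leq_trans _ T4).
(* With [D = T ^ 4] the errors [X ^ 2 / D] and [D ^ 2] have the same order [T ^ 8]. *)
pose X := ((T ^ 3) ^ 2)%N; pose D := (T ^ 4)%N.
have leDX : (D < X)%N by rewrite /D /X -expnM ltn_exp2l // (leq_trans _ T4).
have D_gt0 : (0 < D)%N by rewrite expn_gt0 (leq_trans _ T4).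
have T3_ge4 : (4 <= T ^ 3)%N 
  by rewrite (leq_trans T4) // -{1}(expn1 T) leq_pexp2l // (leq_trans _ T4).
have := weighted_divisor_sum_ge T3_ge4; rewrite -/X weighted_divisor_sumE.
rewrite (@big_cat_nat _ _ _ D.+1 1 X.+1) //=; last by rewrite ltnS ltnW.
have H2 : `|\sum_(D.+1 <= d < X.+1) chi d * G X d| <= C * (X%:R ^+ 2 / (2 * D%:R)).
  apply: (@le_trans _ _ (C * G X D.+1)).
    apply: abel_bound => // d led; first exact: fejer_sum_ge0.
    by apply: fejer_sum_decr; apply: leq_trans led.
  rewrite ler_wpM2l // (le_trans (fejer_sum_decr _ _)) //.
  by apply: fejer_sum_le; rewrite D_gt0 ltnW.
have H1 : `|\sum_(1 <= d < D.+1) chi d * G X d| <=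
    X%:R ^+ 2 / 2 * (C * D%:R^-1) + X%:R / 2 * C + D%:R * D%:R.
  have -> : \sum_(1 <= d < D.+1) chi d * G X d =
     X%:R ^+ 2 / 2 * s D - X%:R / 2 * (\sum_(1 <= d < D.+1) chi d) +
     \sum_(1 <= d < D.+1)
       chi d * ((X %% d)%:R * (d%:R - (X %% d)%:R) / (2 * d%:R)).
    rewrite /s !mulr_sumr -sumrB -big_split /=; apply: eq_big_nat => d /andP[d0 _].
    by rewrite fejer_sumE //; field; rewrite pnatr_eq0 -lt0n.
  apply: le_trans (ler_normD _ _) _; apply: lerD.
    apply: le_trans (ler_normB _ _) _; apply: lerD; rewrite normrM.
      rewrite [`|_ / 2|]ger0_norm ?divr_ge0 ?sqr_ge0 // ler_wpM2l ?divr_ge0 ?sqr_ge0 //.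
      move: (HL D); rewrite L0 subr0 => /le_trans; apply.
      by rewrite ler_wpM2l // lef_pV2 ?posrE ?ltr0n // ler_nat.
    by rewrite [`|_ / 2|]ger0_norm ?divr_ge0 // ler_wpM2l ?divr_ge0.
  apply: le_trans (ler_norm_sum _ _ _) _.
  have -> : D%:R * D%:R = \sum_(1 <= d < D.+1) D%:R :> R.
    by rewrite sumr_const_nat subn1 mulr_natr.
  apply: ler_sum_nat => d /andP[d0]; rewrite ltnS => ledD.
  rewrite normrM -[leRHS]mul1r; apply: ler_pM => //; first exact: norm_chi_le1.
  have d_gt0 : 0 < d%:R :> R by rewrite ltr0n.
  have rd : (X %% d)%:R <= d%:R :> R by rewrite ler_nat ltnW // ltn_pmod.
  have r0 : 0 <= (X %% d)%:R :> R by [].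
  rewrite ger0_norm; last by rewrite divr_ge0 ?mulr_ge0 ?subr_ge0 // ltW.
  rewrite ler_pdivrMr ?mulr_gt0 //.
  have dD : d%:R <= D%:R :> R by rewrite ler_nat.
  have : (X %% d)%:R * (d%:R - (X %% d)%:R) <= d%:R * d%:R :> R.
    by apply: ler_pM; lra.
  have : d%:R * d%:R <= D%:R * d%:R :> R by rewrite ler_wpM2r.
  have : 0 <= D%:R * d%:R :> R by rewrite mulr_ge0.
  by lra.
have EX : X%:R = T%:R ^+ 6 :> R by rewrite /X -expnM natrX.
have ED : D%:R = T%:R ^+ 4 :> R by rewrite natrX.
move: H1 H2; rewrite !ler_norml EX ED natrX => /andP[_ H1] /andP[_ H2] H.
set t := T%:R in T_gt T_gt0 H H1 H2.
have tn0 : t != 0 by rewrite gt_eqF.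
have E1 : (t ^+ 6) ^+ 2 / 2 * (C / t ^+ 4) = C / 2 * t ^+ 8 by field.
have E2 : C * ((t ^+ 6) ^+ 2 / (2 * t ^+ 4)) = C / 2 * t ^+ 8 by field.
rewrite E1 in H1; rewrite E2 in H2.
have C0 := C_ge0; have t1 : 1 <= t by lra.
have t68 : t ^+ 6 * C <= t ^+ 8 * C by rewrite ler_wpM2r // ler_weXn2l.
have t8 : 0 < t ^+ 8 by rewrite exprn_gt0.
have : (4 * C + 4) * t ^+ 8 < t * t ^+ 8 by rewrite ltr_pM2r.
have -> : t * t ^+ 8 = (t ^+ 3) ^+ 3 by ring.
have : t ^+ 4 * t ^+ 4 = t ^+ 8 by ring.
have : 0 <= C * t ^+ 8 by rewrite mulr_ge0 // ltW.
by lra.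
Qed.

End NonVanishing.

(** * Mertens estimates *)

Section Mangoldt.
Variable R : realType.

Definition mangoldt (d : nat) : R :=
  if size (primes d) == 1%N then ln (pdiv d)%:R else 0.

Lemma mangoldt_prime_pow p j : prime p -> mangoldt (p ^ j.+1) = ln p%:R.
Proof.
move=> p_pr; rewrite /mangoldt primesX // primes_prime // eqxx.
by rewrite pdiv_pfactor.
Qed.

Lemma mangoldt_neq0 d : mangoldt d != 0 -> exists p j, prime p /\ d = (p ^ j.+1)%N.
Proof.
rewrite /mangoldt; case: ifP => [|_]; last by rewrite eqxx.
case Ep: (primes d) => [|p [|]] // _ _.
have p_in : p \in primes d by rewrite Ep inE.
have := p_in; rewrite mem_primes => /and3P[p_pr d_gt0 pd].
exists p, (logn p d).-1; split=> //.
rewrite prednK ?logn_gt0 // -p_part part_pnat_id //.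
rewrite /pnat d_gt0 Ep /= andbT; exact: eqxx.
Qed.

Lemma mangoldt_ge0 d : 0 <= mangoldt d.
Proof.
rewrite /mangoldt; case: ifP => // _.
by apply: ln_ge0; rewrite ler1n pdiv_gt0.
Qed.

Lemma ln_nat_ge0 n : 0 <= ln n%:R :> R.
Proof.
case: n => [|n]; first by rewrite ln0.
by apply: ln_ge0; rewrite ler1n.
Qed.

Lemma ler_ln_nat m n : (0 < m)%N -> (m <= n)%N -> ln m%:R <= ln n%:R :> R.
Proof.
move=> m0 lemn; rewrite ler_ln ?posrE ?ltr0n ?ler_nat //.
exact: leq_trans lemn.
Qed.

Lemma ln_natM m n : (0 < m)%N -> (0 < n)%N ->
  ln (m * n)%:R = ln m%:R + ln n%:R :> R.
Proof. by move=> m0 n0; rewrite natrM lnM ?posrE ?ltr0n. Qed.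

Lemma mangoldt_le_ln d : (0 < d)%N -> mangoldt d <= ln d%:R.
Proof.
move=> d_gt0; rewrite /mangoldt; case: ifP => _; last exact: ln_nat_ge0.
by rewrite ler_ln_nat ?pdiv_gt0 // dvdn_leq // pdiv_dvd.
Qed.

(** With [p] the least prime factor of [n], the only prime power dividing [n] but not [n / p] is the
    full power of [p] in [n], which contributes [ln p]. *)
Lemma sum_mangoldt_divisors n : (0 < n)%N ->
  \sum_(d <- divisors n) mangoldt d = ln n%:R.
Proof.
have [k] := ubnP n; elim: k n => // k IHk n ltnk n_gt0.
have [n_le1|n_gt1] := leqP n 1.
  have -> : n = 1%N by apply/eqP; rewrite eqn_leq n_le1.
  by rewrite [divisors 1]/= big_seq1 /mangoldt ln1.
have p_pr := pdiv_prime n_gt1; set p := pdiv n in p_pr.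
have p_gt0 := prime_gt0 p_pr; have p_gt1 := prime_gt1 p_pr.
have [n1 En] := dvdnP (pdiv_dvd n); rewrite mulnC -/p in En.
have n1_gt0 : (0 < n1)%N by move: n_gt0; rewrite En muln_gt0 => /andP[].
have ltn1 : (n1 < k)%N by apply: leq_trans (ltnSE ltnk); rewrite En ltn_Pmull.
rewrite [in RHS]En ln_natM // -(IHk _ ltn1 n1_gt0).
rewrite (bigID (fun d => d %| n1)%N) /= addrC; congr (_ + _); last first.
  rewrite -big_filter; apply: perm_big; apply: uniq_perm;
    rewrite ?filter_uniq ?divisors_uniq // => d.
  rewrite mem_filter -!dvdn_divisors //.
  by case: (boolP (d %| n1)%N) => //= dvd; rewrite En dvdn_mull.
have Elog : logn p n = (logn p n1).+1.
  by rewrite En lognM // [logn p p]logn_prime // eqxx.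
have q_in : (p ^ (logn p n1).+1 \in divisors n)%N.
  by rewrite -dvdn_divisors // -Elog pfactor_dvdnn.
rewrite big_mkcond (bigD1_seq _ q_in) ?divisors_uniq //=.
rewrite pfactor_dvdn // ltnn /= mangoldt_prime_pow //.
rewrite big1_seq ?addr0 // => d /andP[dneq d_in].
case: ifP => // dNn1; apply/eqP; apply: contraT => /mangoldt_neq0[q [j [q_pr Ed]]].
case/negP: dneq; move: d_in; rewrite -dvdn_divisors // => dvd.
have [Eq|qp] := eqVneq q p.
  move: dvd dNn1; rewrite Ed Eq !pfactor_dvdn // Elog -ltnNge !ltnS => le1 le2.
  by apply/eqP; congr (p ^ _.+1)%N; apply/eqP; rewrite eqn_leq le1 le2.
case/negP: dNn1; move: dvd; rewrite Ed En Gauss_dvdr //.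
by rewrite coprimeXl // prime_coprime // dvdn_prime2.
Qed.

Lemma ln_natS_le n : (0 < n)%N -> n%:R * (ln n.+1%:R - ln n%:R) <= 1 :> R.
Proof.
move=> n_gt0; have n0 : 0 < n%:R :> R by rewrite ltr0n.
rewrite -ln_div ?posrE ?ltr0n // mulrC -ler_pdivlMr //.
have -> : n.+1%:R / n%:R = 1 + n%:R^-1 :> R by rewrite -natr1; field; lra.
rewrite mul1r; apply: le_ln1Dx.
by apply: (@lt_trans _ _ 0); rewrite ?ltrN10 ?invr_gt0.
Qed.

Lemma sum_ln_ge n : (0 < n)%N ->
  n%:R * ln n%:R - n%:R <= \sum_(1 <= i < n.+1) ln i%:R :> R.
Proof.
elim: n => // -[|n] IHn _; first by rewrite big_nat1 ln1 mulr0 sub0r lerN10.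
rewrite big_nat_recr //=; have := IHn isT; have := @ln_natS_le n.+1 isT.
set a := ln n.+2%:R; set b := ln n.+1%:R; set S := \sum_(_ <= _ < _) _.
by rewrite -(natr1 n.+1); lra.
Qed.

Lemma sum_mangoldt_floor X :
  \sum_(1 <= d < X.+1) mangoldt d * (X %/ d)%:R = \sum_(1 <= n < X.+1) ln n%:R.
Proof.
under [RHS]eq_big_nat => n /andP[n0 _] do rewrite -sum_mangoldt_divisors //.
rewrite (sum_dirichlet_convolution (fun d _ => mangoldt d)).
by apply: eq_bigr => d _; rewrite sumr_const_nat subn1 mulr_natr.
Qed.

(** The sum of [mangoldt d * (X %/ d)] is the logarithm of [X!]; Stirling's lower bound applies to
    it, and dropping the floor only enlarges the terms. *)
Lemma mertens_ge X : (0 < X)%N ->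
  ln X%:R - 1 <= \sum_(1 <= d < X.+1) mangoldt d / d%:R.
Proof.
move=> X_gt0; have X0 : 0 < X%:R :> R by rewrite ltr0n.
rewrite -(ler_pM2l X0) mulrBr mulr1; apply: le_trans (sum_ln_ge X_gt0) _.
rewrite -sum_mangoldt_floor mulr_sumr; apply: ler_sum_nat => d /andP[d_gt0 _].
rewrite mulrCA ler_wpM2l ?mangoldt_ge0 // ler_pdivlMr ?ltr0n //.
by rewrite -natrM ler_nat leq_trunc_div.
Qed.

Definition psi X : R := \sum_(1 <= d < X.+1) mangoldt d.

Lemma ln2_le1 : ln 2 <= 1 :> R.
Proof. by have := @le_ln1Dx R 1; rewrite (_ : 1 + 1 = 2 :> R) //; apply; lra. Qed.

(** Chebyshev's argument: the logarithm of the central binomial coefficient is the sum of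
    [mangoldt d] times [(2 m %/ d) - 2 (m %/ d)], a factor that is nonnegative, and 1 for
    [m < d <= 2 m]. *)
Lemma psi_double m : psi (2 * m) - psi m <= 2 * m%:R.
Proof.
(* Going from [m] to [m + 1] adds at most [2 ln 2], and [ln 2 <= 1]. *)
have E : \sum_(1 <= n < (2 * m).+1) ln n%:R - 2 * \sum_(1 <= n < m.+1) ln n%:R
   <= 2 * m%:R :> R.
  elim: m => [|m IHm]; first by rewrite muln0 !big_geq // !mulr0 subrr.
  rewrite mulnS add2n (@big_nat_recr _ _ _ (2 * m).+2 1) //.
  rewrite (@big_nat_recr _ _ _ (2 * m).+1 1) // (@big_nat_recr _ _ _ m.+1 1) //=.
  have -> : (2 * m).+2 = (2 * m.+1)%N by lia.
  rewrite [ln (2 * m.+1)%:R]ln_natM //.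
  have : ln (2 * m).+1%:R <= ln 2%:R + ln m.+1%:R :> R.
    by rewrite -ln_natM // ler_ln_nat //; lia.
  have : ln 2%:R <= 1 :> R by exact: ln2_le1.
  have -> : m.+1%:R = m%:R + 1 :> R by rewrite natr1.
  move: IHm; set S := \sum_(_ <= _ < _) _; set S' := \sum_(_ <= _ < _) _.
  move: S S' (ln 2%:R) (ln (2 * m).+1%:R) (ln (m%:R + 1)) => S S' a b c; lra.
apply: le_trans E; rewrite -!sum_mangoldt_floor /psi.
have le_m : (m.+1 <= (2 * m).+1)%N by lia.
have Em2 : \sum_(1 <= d < m.+1) mangoldt d * (m %/ d)%:R =
          \sum_(1 <= d < (2 * m).+1) mangoldt d * (m %/ d)%:R.
  rewrite (@big_cat_nat _ _ _ m.+1 1 (2 * m).+1) //=.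
  rewrite [X in _ = _ + X](_ : _ = 0) ?addr0 //.
  rewrite big_nat big1 // => d /andP[ltmd _].
  by rewrite divn_small // mulr0.
rewrite Em2 mulr_sumr -sumrB.
rewrite [X in X - _](@big_cat_nat _ _ _ m.+1 1 (2 * m).+1) //= addrAC subrr add0r.
rewrite [leRHS](@big_cat_nat _ _ _ m.+1 1 (2 * m).+1) //=.
rewrite -[leLHS]add0r; apply: lerD.
  rewrite big_nat; apply: sumr_ge0 => d /andP[d_gt0 _].
  rewrite mulrCA -mulrBr mulr_ge0 ?mangoldt_ge0 // subr_ge0 -natrM ler_nat.
  by rewrite leq_divRL // -mulnA leq_mul2l leq_trunc_div.
apply: ler_sum_nat => d /andP[ltmd ltd2].
rewrite (@divn_small m d) // mulr0 mulr0 subr0 ler_peMr ?mangoldt_ge0 //.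
by rewrite ler1n divn_gt0 // (leq_ltn_trans _ ltmd).
Qed.

Lemma psi_pow2_le k : psi (2 ^ k) <= 2 * (2 ^ k)%:R.
Proof.
elim: k => [|k IHk].
  by rewrite /psi big_nat1 /mangoldt /= expn0; lra.
have := psi_double (2 ^ k); rewrite -expnS.
have -> : (2 ^ k.+1)%:R = 2 * (2 ^ k)%:R :> R by rewrite expnS natrM.
by lra.
Qed.

End Mangoldt.

Section RealDirichlet.
Variable R : realType.

Lemma ln_div_decr n : (4 <= n)%N ->
  ln n.+1%:R / n.+1%:R <= ln n%:R / n%:R :> R.
Proof.
move=> n_ge4; have n_gt0 : (0 < n)%N by apply: leq_trans n_ge4.
have n0 : 0 < n%:R :> R by rewrite ltr0n.
rewrite ler_pdivrMr ?ltr0n // mulrAC ler_pdivlMr //.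
have := @ln_natS_le R n n_gt0.
have ln4 : 1 <= ln n%:R :> R.
  apply: (@le_trans _ _ (ln 4%:R)); last by rewrite ler_ln_nat.
  have -> : (4 = 2 * 2)%N by [].
  rewrite ln_natM //.
  have : ln (1 + - 2^-1) <= - 2^-1 :> R by apply: le_ln1Dx; lra.
  have -> : 1 + - 2^-1 = 2%:R^-1 :> R by field.
  rewrite lnV ?posrE ?ltr0n //; lra.
have -> : n.+1%:R = n%:R + 1 :> R by rewrite natr1.
move: (ln n%:R) (ln (n%:R + 1)) ln4 => a b; nra.
Qed.

Lemma ln_div_le1 n : ln n%:R / n%:R <= 1 :> R.
Proof.
case: n => [|n]; first by rewrite invr0 mulr0 ler01.
by rewrite ler_pdivrMr ?ltr0n // mul1r ltW // ln_sublinear ?ltr0n.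
Qed.

(* As [ln] is the convolution of [1] and the von Mangoldt function, the bounded
   sum of [chi n * ln n / n] is [L] times the sum to be bounded, up to an error
   that Chebyshev's estimate controls. *)
Lemma mertens_character (chi : nat -> R) (C : R) :
    (forall m n, chi (m * n)%N = chi m * chi n) -> chi 1%N = 1 ->
    (forall n, [\/ chi n = 0, chi n = 1 | chi n = -1]) ->
    (forall a b, `|\sum_(a <= n < b) chi n| <= C) ->
  exists K, forall k,
    `|\sum_(1 <= d < (2 ^ k).+1) chi d * (mangoldt R d / d%:R)| <= K.
Proof.
move=> chiM chi1 chi_val chi_sum.
have C_ge0 : 0 <= C by exact: le_trans (chi_sum 0 0)%N.
have [L HL] := partial_L_lim chi_sum.
have L0 : 0 < `|L| by rewrite normr_gt0 (L_neq0 chiM chi1 chi_val chi_sum HL).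
exists ((3 + C + 2 * C) / `|L|) => k; rewrite ler_pdivlMr // -normrM.
set X := (2 ^ k)%N; have X_gt0 : (0 < X)%N by rewrite expn_gt0.
pose T := \sum_(1 <= n < X.+1) chi n * (ln n%:R / n%:R).
(* The first three terms are at most 1 in size; from 4 on [ln n / n] decreases and Abel summation
   bounds the tail by [C]. *)
have T_le : `|T| <= 3 + C.
  have tail : `|\sum_(4 <= n < X.+1) chi n * (ln n%:R / n%:R)| <= C.
    apply: (@le_trans _ _ (C * (ln 4%:R / 4%:R))); last first.
      by rewrite -[leRHS]mulr1 ler_wpM2l // ln_div_le1.
    apply: (@abel_bound R chi (fun n => ln n%:R / n%:R)) => // n le4n.
      by rewrite divr_ge0 // ln_nat_ge0.
    exact: ln_div_decr.
  have term n : `|chi n * (ln n%:R / n%:R)| <= 1.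
    rewrite normrM -[leRHS]mulr1; apply: ler_pM => //; first exact: norm_chi_le1.
    by rewrite ger0_norm ?divr_ge0 ?ln_nat_ge0 ?ln_div_le1.
  have [le3|gt3] := leqP X 3.
    apply: (@le_trans _ _ (\sum_(1 <= n < X.+1) 1)).
      apply: le_trans (ler_norm_sum _ _ _) _; apply: ler_sum => n _; exact: term.
    rewrite sumr_const_nat subn1 /=.
    have : X%:R <= 3 :> R by rewrite ler_nat.
    by lra.
  rewrite /T (@big_cat_nat _ _ _ 4 1 X.+1) //=; last by rewrite ltnS ltnW.
  apply: le_trans (ler_normD _ _) _; apply: lerD => //.
  apply: (@le_trans _ _ (\sum_(1 <= n < 4) 1)).
    apply: le_trans (ler_norm_sum _ _ _) _; apply: ler_sum => n _; exact: term.
  by rewrite sumr_const_nat.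
have ET : T = \sum_(1 <= d < X.+1) chi d * (mangoldt R d / d%:R) *
     \sum_(1 <= m < (X %/ d).+1) chi m * m%:R^-1.
  transitivity (\sum_(1 <= n < X.+1) \sum_(d <- divisors n)
    (chi d * (mangoldt R d / d%:R)) * (chi (n %/ d)%N / (n %/ d)%N%:R)).
    apply: eq_big_nat => n /andP[n0 _].
    rewrite -sum_mangoldt_divisors // mulr_suml mulr_sumr.
    rewrite big_seq [RHS]big_seq; apply: eq_bigr => d.
    rewrite -dvdn_divisors // => /dvdnP[m En].
    have [m0 d0] : (0 < m)%N /\ (0 < d)%N.
      by move: n0; rewrite En muln_gt0 => /andP[].
    rewrite En mulnK // chiM natrM; field.
    by rewrite !pnatr_eq0 -!lt0n m0.
  rewrite (sum_dirichlet_convolution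
    (fun d m => (chi d * (mangoldt R d / d%:R)) * (chi m / m%:R))).
  by apply: eq_bigr => d _; rewrite mulr_sumr.
set S := \sum_(1 <= d < X.+1) chi d * (mangoldt R d / d%:R).
(* Replacing the inner sum by [L] costs at most [mangoldt d * C / X] in the term of [d], in total
   [C * psi X / X]; Chebyshev's bound is available because [X] is a power of 2. *)
have dist : `|S * L - T| <= 2 * C.
  rewrite ET /S mulr_suml -sumrB.
  apply: le_trans (ler_norm_sum _ _ _) _.
  apply: (@le_trans _ _ (\sum_(1 <= d < X.+1) mangoldt R d * (C / X%:R))).
    apply: ler_sum_nat => d /andP[d0 _]; rewrite -mulrBr normrM.
    have d_gt0 : 0 < d%:R :> R by rewrite ltr0n.
    have -> : mangoldt R d * (C / X%:R) =
              (mangoldt R d / d%:R) * (C * (d%:R / X%:R)).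
      by field; rewrite !pnatr_eq0 -!lt0n d0 X_gt0.
    apply: ler_pM => //.
      rewrite normrM -[leRHS]mul1r; apply: ler_pM => //.
        exact: norm_chi_le1.
      by rewrite ger0_norm ?divr_ge0 ?mangoldt_ge0.
    rewrite distrC; apply: le_trans (HL _) _; rewrite ler_wpM2l //.
    rewrite ler_pdivlMr ?ltr0n // mulrC ler_pdivrMr ?ltr0n // -natrM ler_nat.
    by rewrite mulnC ltnW // ltn_ceil.
  rewrite -mulr_suml mulrA ler_pdivrMr ?ltr0n //.
  have := psi_pow2_le R k; rewrite -/X /psi => /(ler_wpM2r C_ge0).
  by move: (\sum_(_ <= _ < _) _) => u; lra.
have -> : S * L = (S * L - T) + T by ring.
apply: le_trans (ler_normD _ _) _; lra.
Qed.

End RealDirichlet.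

(** * Primes with prescribed quadratic characters *)

Section PeriodicCharacter.
Variables (R : realType) (f : nat -> R) (N : nat).
Hypothesis N_gt0 : (0 < N)%N.
Hypothesis fM : forall m n, f (m * n)%N = f m * f n.
Hypothesis f_per : forall n, f (n + N)%N = f n.
Hypothesis f_le1 : forall n, `|f n| <= 1.

Lemma periodic_modn n : f (n %% N)%N = f n.
Proof.
rewrite [in RHS](divn_eq n N); elim: (n %/ N)%N => [|q IHq]; first by rewrite mul0n.
by rewrite mulSnr addnAC f_per.
Qed.

(** Multiplication by [u] permutes the residues modulo [N] and changes the sign of the sum. *)
Lemma character_period_sum0 u : coprime u N -> f u = -1 ->
  \sum_(0 <= n < N) f n = 0.
Proof.
move=> cop fu; rewrite big_mkord.
pose h (i : 'I_N) : 'I_N := Ordinal (ltn_pmod (u * i) N_gt0).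
have h_inj : injective h.
  move=> i j /(congr1 val) /= /eqP.
  wlog leij : i j / (i <= j)%N.
    by case: (leqP i j) => [|/ltnW] le H /eqP E; [|apply/esym]; apply: H => //; rewrite E.
  rewrite eq_sym eqn_mod_dvd ?leq_mul2l ?leij ?orbT // -mulnBr Gauss_dvdr; last first.
    by rewrite coprime_sym.
  move=> dvd; apply/val_inj/eqP; rewrite eqn_leq leij /= -subn_eq0.
  have lt : (j - i < N)%N by rewrite (leq_ltn_trans (leq_subr _ _)).
  by move: dvd; rewrite /dvdn modn_small.
have : \sum_(i < N) f i = - \sum_(i < N) f i.
  rewrite [LHS](reindex_inj h_inj) /= -mulN1r -fu mulr_sumr.
  by apply: eq_bigr => i _; rewrite periodic_modn fM.
by move=> E; apply/eqP; rewrite -[_ == 0](@mulrn_eq0 _ _ 2) mulr2n {1}E addNr.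
Qed.

Lemma character_sum_bound u : coprime u N -> f u = -1 ->
  forall a b, `|\sum_(a <= n < b) f n| <= 2 * N%:R.
Proof.
move=> cop fu.
have shift m : \sum_(0 <= n < m + N) f n = \sum_(0 <= n < m) f n.
  rewrite (@big_cat_nat _ _ _ N 0 (m + N)) ?leq_addl //=.
  rewrite (character_period_sum0 cop fu) add0r -{1}[N]add0n big_addn addnK.
  by apply: eq_bigr => n _; exact: f_per.
have bound0 b : `|\sum_(0 <= n < b) f n| <= N%:R.
  rewrite (divn_eq b N).
  have -> : \sum_(0 <= n < b %/ N * N + b %% N) f n = \sum_(0 <= n < b %% N) f n.
    elim: (b %/ N)%N => [|q IHq]; first by rewrite mul0n.
    by rewrite mulSnr addnAC shift.
  apply: le_trans (ler_norm_sum _ _ _) _.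
  apply: (@le_trans _ _ (\sum_(0 <= n < b %% N) 1)); first by apply: ler_sum.
  by rewrite sumr_const_nat subn0 ler_nat ltnW // ltn_pmod.
move=> a b; have [ltba|leab] := ltnP b a.
  by rewrite big_geq ?normr0 ?mulr_ge0 // ltnW.
have -> : \sum_(a <= n < b) f n = \sum_(0 <= n < b) f n - \sum_(0 <= n < a) f n.
  by rewrite (@big_cat_nat _ _ _ a 0 b) //= addrAC subrr add0r.
apply: le_trans (ler_normB _ _) _.
by have := bound0 a; have := bound0 b; lra.
Qed.

End PeriodicCharacter.

Section SquareTail.
Variable R : realType.

Lemma sum_inv_sqr_le n : \sum_(1 <= m < n.+1) (m%:R ^+ 2)^-1 <= 2 :> R.
Proof.
case: n => [|n]; first by rewrite big_geq.
suff : \sum_(1 <= m < n.+2) (m%:R ^+ 2)^-1 <= 2 - n.+1%:R^-1 :> R.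
  by move/le_trans; apply; rewrite gerBl invr_ge0.
elim: n => [|n IHn]; first by rewrite big_nat1 expr1n invr1; lra.
rewrite big_nat_recr //=; apply: le_trans (lerD IHn (lexx _)) _.
rewrite -(natr1 n.+1); set x := n.+1%:R.
have x0 : 0 < x by rewrite ltr0n.
rewrite -subr_ge0.
have -> : 2 - (x + 1)^-1 - (2 - x^-1 + ((x + 1) ^+ 2)^-1) =
          (x * (x + 1) ^+ 2)^-1 by field; lra.
by rewrite invr_ge0 mulr_ge0 ?sqr_ge0 // ltW.
Qed.

(** Induction on the sharper bound [2 - (ln n + 2) / n], modelled on the integral of
    [ln x / x ^ 2]. *)
Lemma sum_ln_div_sqr_le n : \sum_(1 <= m < n.+1) ln m%:R / m%:R ^+ 2 <= 2 :> R.
Proof.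
case: n => [|n]; first by rewrite big_geq.
suff : \sum_(1 <= m < n.+2) ln m%:R / m%:R ^+ 2 <=
       2 - (ln n.+1%:R + 2) / n.+1%:R :> R.
  move/le_trans; apply; rewrite gerBl divr_ge0 // addr_ge0 // ln_nat_ge0 //.
elim: n => [|n IHn]; first by rewrite big_nat1 ln1; lra.
rewrite big_nat_recr //=; apply: le_trans (lerD IHn (lexx _)) _.
have := @ln_natS_le R n.+1 isT; have := ln_nat_ge0 R n.+2.
rewrite -(natr1 n.+1); set x := n.+1%:R; set a := ln x; set b := ln (x + 1).
have x1 : 1 <= x by rewrite ler1n.
move=> b0 Hab; rewrite -subr_ge0.
have -> : 2 - (b + 2) / (x + 1) - (2 - (a + 2) / x + b / (x + 1) ^+ 2) =
   ((x + 1) * (a + 2 - x * (b - a) - b) + b) / (x * (x + 1) ^+ 2) by field; lra.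
rewrite divr_ge0 ?mulr_ge0 ?sqr_ge0 ?addr_ge0 //; try lra.
rewrite mulr_ge0 //; first lra.
have : b - a <= 1 by nra.
by lra.
Qed.

End SquareTail.

Lemma ler_term_sum (R : realFieldType) (F : nat -> R) a b i :
  (forall n, 0 <= F n) -> (a <= i < b)%N -> F i <= \sum_(a <= n < b) F n.
Proof.
move=> F0 Hi; rewrite -(big_seq1 +%R i F).
apply: ler_sum_subseq; rewrite ?iota_uniq // => j.
by rewrite inE mem_index_iota => /eqP ->.
Qed.

Section PrimeWithSigns.
Variables (R : realType) (I : finType) (chi : I -> nat -> int) (N : nat).
Hypothesis N_gt0 : (0 < N)%N.
Hypothesis chiM : forall i m n, chi i (m * n)%N = chi i m * chi i n.
Hypothesis chi1 : forall i, chi i 1%N = 1.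
Hypothesis chi_per : forall i n, chi i (n + N)%N = chi i n.
Hypothesis chi_val : forall i n, [\/ chi i n = 0, chi i n = 1 | chi i n = -1].
Hypothesis chi_unit : forall i n, coprime n N -> chi i n != 0.
Hypothesis chi_indep : forall i, exists u,
  [/\ coprime u N, chi i u = -1 & forall j, j != i -> chi j u = 1].

Let chiR (J : {set I}) (n : nat) : R := \prod_(i in J) (chi i n)%:~R.

Lemma chiR_M J m n : chiR J (m * n)%N = chiR J m * chiR J n.
Proof.
by rewrite /chiR -big_split; apply: eq_bigr => i _; rewrite chiM rmorphM.
Qed.

Lemma chiR_1 J : chiR J 1%N = 1.
Proof. by rewrite /chiR big1 // => i _; rewrite chi1. Qed.

Lemma chiR_val J n : [\/ chiR J n = 0, chiR J n = 1 | chiR J n = -1].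
Proof.
rewrite /chiR.
apply: (big_ind (fun x : R => [\/ x = 0, x = 1 | x = -1])) => [|x y|i _]; first by apply: Or32.
  by do 2![case=> ->]; rewrite ?(mul0r, mulr0, mul1r, mulr1, mulrNN);
     do ?[by apply: Or31 | by apply: Or32 | by apply: Or33].
by case: (chi_val i n) => ->; [apply: Or31|apply: Or32|apply: Or33].
Qed.

(** By independence some [u] prime to [N] has value -1 at one chosen member of [J] and 1 at all
    others, so the product is not principal. *)
Lemma chiR_sum J : J != set0 ->
  forall a b, `|\sum_(a <= n < b) chiR J n| <= 2 * N%:R.
Proof.
case/set0Pn => i iJ; have [u [cop ui uj]] := chi_indep i.
apply: (@character_sum_bound R (chiR J) N N_gt0 (chiR_M J) _ _ u) => //.
- by move=> n; apply: eq_bigr => j _; rewrite chi_per.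
- by move=> n; case: (chiR_val J n) => ->; rewrite ?normrN ?normr0 ?normr1.
rewrite /chiR (bigD1 i) //= ui big1 ?mulr1 // => j /andP[_ /uj ->].
by [].
Qed.

Variable eps : I -> bool.
(** For [d] prime to [N] this is [2 ^ #|I|] if all characters take the prescribed signs at [d], and
    0 otherwise. *)
Let W (d : nat) : R := \prod_i (1 + (-1) ^+ eps i * (chi i d)%:~R).

Lemma sign_weight_bounds d : 0 <= W d <= 2 ^+ #|I|.
Proof.
pose x i : R := 1 + (-1) ^+ eps i * (chi i d)%:~R.
have b i : 0 <= x i <= 2.
  rewrite /x; case: (eps i); case: (chi_val i d) => -> /=;
    by rewrite ?expr1 ?expr0; apply/andP; split; lra.
rewrite /W prodr_ge0 => [|i _]; last by case/andP: (b i).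
rewrite -prodr_const; apply: ler_prod => i _; exact: b.
Qed.

(** Expand the product over the subsets of [I]: the empty set gives Mertens' sum, at least
    [ln X - 1], and every other subset a nonprincipal character, with bounded sum. *)
Lemma sign_weight_mertens : exists K, forall k,
  ln (2 ^ k)%:R - K <= \sum_(1 <= d < (2 ^ k).+1) W d * (mangoldt R d / d%:R).
Proof.
have H (J : {set I}) : exists K, J != set0 -> forall k,
    `|\sum_(1 <= d < (2 ^ k).+1) chiR J d * (mangoldt R d / d%:R)| <= K.
  have [->|J0] := eqVneq J set0; first by exists 0.
  have [K HK] := mertens_character (chiR_M J) (chiR_1 J) (chiR_val J) (chiR_sum J0).
  by exists K.
have [K HK] := choice H.
exists (1 + \sum_(J : {set I} | J != set0) K J) => k.
pose e (J : {set I}) : R := \prod_(i in J) (-1) ^+ eps i.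
have e_norm J : `|e J| = 1.
  by rewrite /e normr_prod big1 // => i _; rewrite normrX normrN1 expr1n.
have EW d : W d = 1 + \sum_(J : {set I} | J != set0) e J * chiR J d.
  have -> : W d = \sum_(J : {set I}) e J * chiR J d.
    rewrite /W; under eq_bigr do rewrite addrC.
    rewrite bigA_distr; apply: eq_bigr => J _.
    rewrite /e /chiR -big_split /= [RHS]big_mkcond.
    by apply: eq_bigr => i _.
  rewrite (bigD1 set0) //=; congr (_ + _).
  by rewrite /e /chiR !big_set0 mulr1.
have -> : \sum_(1 <= d < (2 ^ k).+1) W d * (mangoldt R d / d%:R) =
   \sum_(1 <= d < (2 ^ k).+1) mangoldt R d / d%:R +
   \sum_(J : {set I} | J != set0) e J *
      \sum_(1 <= d < (2 ^ k).+1) chiR J d * (mangoldt R d / d%:R).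
  under [X in _ = _ + X]eq_bigr do rewrite mulr_sumr.
  rewrite exchange_big -big_split /=; apply: eq_bigr => d _.
  rewrite EW mulrDl mul1r mulr_suml; congr (_ + _).
  by apply: eq_bigr => J _; rewrite -mulrA.
have := @mertens_ge R (2 ^ k) _; rewrite expn_gt0 => /(_ isT) Hm.
suff : - \sum_(J : {set I} | J != set0) K J <= \sum_(J : {set I} | J != set0) e J *
      \sum_(1 <= d < (2 ^ k).+1) chiR J d * (mangoldt R d / d%:R).
  move: Hm; set A := \sum_(_ <= _ < _) _; set B := \sum_(_ | _) _.
  by set D := \sum_(_ | _) _; set l := ln _; lra.
rewrite -sumrN; apply: ler_sum => J J0; rewrite lerNl.
apply: le_trans (HK J J0 k); rewrite -[leRHS]mul1r -(e_norm J) -normrM.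
by rewrite -[X in _ <= X]normrN ler_norm.
Qed.

(* On a prime power [p ^ j] with [j] odd the characters take the same values as
   on [p], so [W] vanishes there unless [p] divides [N]. *)
Lemma sign_weight_support d :
    (forall p, prime p -> ~ (forall i, chi i p = (-1) ^+ eps i)) ->
    W d * mangoldt R d != 0 ->
  exists e m, (0 < e <= N)%N /\ d = (e * m ^ 2)%N.
Proof.
move=> noprime; rewrite mulf_eq0 negb_or => /andP[Wd /mangoldt_neq0[p [j [p_pr Ed]]]].
(* The exponent is [j.+1], so odd [j] makes [d] a square. For even [j], [d] is [p] times a square
   and [p <= N] remains to be shown. *)
have [jodd|jeven] := boolP (odd j).
  exists 1%N, (p ^ j.+1./2)%N; rewrite N_gt0; split=> //.
  have Ej : j.+1 = (j.+1./2).*2 by rewrite -[LHS]odd_double_half /= jodd.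
  by rewrite mul1n -expnM muln2 -Ej.
have Ej : j = j./2.*2 by rewrite -[LHS]odd_double_half (negbTE jeven).
exists p, (p ^ j./2)%N; split; last by rewrite Ed expnS -expnM muln2 -Ej.
rewrite prime_gt0 //= leqNgt; apply/negP => ltNp.
have cop : coprime p N.
  by rewrite prime_coprime //; apply/negP => /(dvdn_leq N_gt0); rewrite leqNgt ltNp.
apply: (noprime p p_pr) => i.
have chiX n : chi i (p ^ n)%N = chi i p ^+ n.
  by elim: n => [|n IHn]; rewrite ?expn0 ?chi1 // expnS chiM IHn exprS.
have chid : chi i d = chi i p.
  rewrite Ed chiX exprS Ej -mul2n exprM.
  have := chi_unit i cop; case: (chi_val i p) => ->; rewrite ?eqxx //= => _.
    by rewrite !expr1n mulr1.
  by rewrite sqrrN !expr1n mulr1.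
move: Wd; rewrite /W prodf_seq_neq0 => /allP/(_ i); rewrite mem_index_enum => /(_ isT).
rewrite /= chid; have := chi_unit i cop.
by case: (chi_val i p) => ->; case: (eps i) => //=;
   rewrite ?expr1 ?expr0 ?mulN1r ?mul1r ?subrr ?eqxx //= ?rmorphN ?opprK ?addrN ?eqxx.
Qed.

(** Without such a prime, the weighted sum runs only over numbers [e m ^ 2] with [e <= N] and stays
    bounded, against its growth like [ln X]. *)
Lemma prime_with_signs : exists p, prime p /\ forall i, chi i p = (-1) ^+ eps i.
Proof.
apply: contrapT => Hno.
have noprime p : prime p -> ~ (forall i, chi i p = (-1) ^+ eps i).
  by move=> p_pr Hp; apply: Hno; exists p.
have [K HK] := sign_weight_mertens.
pose B : R := 2 ^+ #|I|.
have B_ge0 : 0 <= B by rewrite exprn_ge0.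
(* For [d = e m ^ 2] with [e <= N], [mangoldt d] is at most [ln N + 2 ln m] and [d] is at least
   [m ^ 2]. *)
pose c m : R := B * ((ln N%:R + 2 * ln m%:R) / m%:R ^+ 2).
have c_ge0 m : 0 <= c m.
  by rewrite mulr_ge0 // divr_ge0 ?sqr_ge0 // addr_ge0 ?mulr_ge0 ?ln_nat_ge0.
have upper X : \sum_(1 <= d < X.+1) W d * (mangoldt R d / d%:R) <=
               N%:R * (B * (2 * ln N%:R + 4)).
  (* [t] spreads the bound over all pairs [(e, m)]; several pairs for the same [d] only enlarge the
     sum. *)
  pose t d e m : R := c m * (e * m ^ 2 == d)%N%:R.
  have t_ge0 d e m : 0 <= t d e m by rewrite mulr_ge0.
  apply: (@le_trans _ _ (\sum_(1 <= d < X.+1) \sum_(1 <= e < N.+1)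
                         \sum_(1 <= m < X.+1) t d e m)).
    apply: ler_sum_nat => d /andP[d_gt0 ledX].
    have s_ge0 e : 0 <= \sum_(1 <= m < X.+1) t d e m by apply: sumr_ge0.
    have [W0|Wn0] := eqVneq (W d * mangoldt R d) 0.
      by rewrite mulrA W0 mul0r; apply: sumr_ge0.
    have [e [m [/andP[e0 leN] Ed]]] := sign_weight_support noprime Wn0.
    have m0 : (0 < m)%N by move: d_gt0; rewrite Ed muln_gt0 expn_gt0 orbF => /andP[].
    have m2_gt0 : (0 < m ^ 2)%N by rewrite expn_gt0 m0.
    have lem : (m < X.+1)%N.
      apply: leq_ltn_trans ledX; rewrite Ed.
      by apply: (leq_trans (leq_pmulr m m0)); rewrite mulnn leq_pmull.
    apply: le_trans (ler_term_sum s_ge0 (_ : 1 <= e < N.+1)%N); last by rewrite e0.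
    apply: le_trans (ler_term_sum (t_ge0 d e) (_ : 1 <= m < X.+1)%N); last by rewrite m0.
    rewrite /t -Ed eqxx mulr1 /c.
    have /andP[W0 WB] := sign_weight_bounds d.
    apply: ler_pM => //; first by rewrite divr_ge0 ?mangoldt_ge0.
    apply: ler_pM; rewrite ?mangoldt_ge0 ?invr_ge0 //.
      apply: le_trans (mangoldt_le_ln R d_gt0) _.
      rewrite Ed ln_natM // natrX lnXn ?ltr0n // mulr_natl lerD2r.
      exact: ler_ln_nat.
    rewrite lef_pV2 ?posrE ?exprn_gt0 ?ltr0n // -natrX ler_nat Ed.
    exact: leq_pmull.
  rewrite exchange_big /=.
  have -> : N%:R * (B * (2 * ln N%:R + 4)) =
     \sum_(1 <= e < N.+1) (B * (2 * ln N%:R + 4)) :> R.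
    by rewrite sumr_const_nat subn1 mulr_natl.
  apply: ler_sum => e _; rewrite exchange_big /=.
  apply: (@le_trans _ _ (\sum_(1 <= m < X.+1) c m)).
    apply: ler_sum => m _; rewrite /t -mulr_sumr -[leRHS]mulr1 ler_wpM2l //.
    have [inr|ninr] := boolP (e * m ^ 2 \in index_iota 1 X.+1)%N.
      rewrite (bigD1_seq _ inr) ?iota_uniq //= eqxx big1 ?addr0 // => d dn.
      by rewrite eq_sym (negbTE dn).
    rewrite big1_seq // => d /andP[_ dr]; case: eqP => // E.
    by rewrite E dr in ninr.
  rewrite /c -mulr_sumr ler_wpM2l //.
  have -> : \sum_(1 <= m < X.+1) (ln N%:R + 2 * ln m%:R) / m%:R ^+ 2 =
    ln N%:R * \sum_(1 <= m < X.+1) (m%:R ^+ 2)^-1 +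
    2 * \sum_(1 <= m < X.+1) ln m%:R / m%:R ^+ 2 :> R.
    rewrite !mulr_sumr -big_split; apply: eq_bigr => m _.
    by rewrite mulrDl mulrA.
  have H1 := sum_inv_sqr_le R X; have H2 := sum_ln_div_sqr_le R X.
  have := ler_wpM2l (ln_nat_ge0 R N) H1.
  move: H2; set u := \sum_(_ <= _ < _) _; set v := \sum_(_ <= _ < _) _.
  by set l := ln _; lra.
pose M : R := K + N%:R * (B * (2 * ln N%:R + 4)).
have ub k : k%:R * ln 2%:R <= M :> R.
  have := le_trans (HK k) (upper (2 ^ k)%N).
  rewrite natrX lnXn ?ltr0n // -[ln _ *+ k]mulr_natl /M.
  by move: (k%:R * _) (N%:R * _) => u v; lra.
have ln2 : 1 / 2 <= ln 2%:R :> R.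
  have : ln (1 + - 2^-1) <= - 2^-1 :> R by apply: le_ln1Dx; lra.
  have -> : 1 + - 2^-1 = 2%:R^-1 :> R by field.
  by rewrite lnV ?posrE ?ltr0n //; lra.
have kgt : 2 * M < (Num.truncn (2 * M)).+1%:R by exact: truncnS_gt.
have := ub (Num.truncn (2 * M)).+1; move: kgt.
have : 0 <= (Num.truncn (2 * M)).+1%:R :> R by [].
move: ((Num.truncn (2 * M)).+1%:R) (ln 2%:R) ln2 => k l l2 k0 Hk Hkl.
have : k * (1 / 2) <= k * l by rewrite ler_wpM2l.
by lra.
Qed.

End PrimeWithSigns.

(** * Legendre symbols and quadratic reciprocity *)

(** Lifts equalities of symbols from a field where 1 and -1 differ back to the integers. *)
Lemma sign_intr_inj (F : fieldType) (a b : int) : 1 != -1 :> F ->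
    [\/ a = 0, a = 1 | a = -1] -> [\/ b = 0, b = 1 | b = -1] ->
  a%:~R = b%:~R :> F -> a = b.
Proof.
move=> n1; have o0 := oner_neq0 F.
have m0 : -1 != 0 :> F by rewrite oppr_eq0.
by do 2![case=> ->] => //= /eqP; rewrite ?rmorphN /= ?rmorph0 ?rmorph1;
   rewrite ?(eq_sym 0) ?(eq_sym (-1) 1) ?(negbTE n1) ?(negbTE o0) ?(negbTE m0).
Qed.

Section QuadraticCharacter.
Variable F : finFieldType.

Definition qchar (x : F) : int :=
  if x == 0 then 0 else if [exists y : F, y ^+ 2 == x] then 1 else -1.

Lemma finfield_expf_pred (x : F) : x != 0 -> x ^+ #|F|.-1 = 1.
Proof.
move=> x0; apply: (mulfI x0).
by rewrite mulr1 -exprS prednK ?expf_card // (cardD1 0) inE.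
Qed.

Lemma finfield_prim_root : exists z : F, #|F|.-1.-primitive_root z.
Proof.
have n_gt0 : (0 < #|F|.-1)%N by rewrite -subn1 subn_gt0 finNzRing_gt1.
have /hasP[z _ Hz] : has #|F|.-1.-primitive_root [seq x <- enum F | x != 0].
  apply: has_prim_root => //; last 1 first.
  - rewrite size_filter; have := count_predC (pred1 (0 : F)) (enum F).
    by rewrite -cardT count_uniq_mem ?enum_uniq // mem_enum add1n => <-.
  - apply/allP => x; rewrite mem_filter => /andP[x0 _].
    by rewrite unity_rootE finfield_expf_pred.
  by apply: filter_uniq; exact: enum_uniq.
by exists z.
Qed.

Lemma qchar0 : qchar 0 = 0. Proof. by rewrite /qchar eqxx. Qed.

Lemma qchar_val x : [\/ qchar x = 0, qchar x = 1 | qchar x = -1].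
Proof.
by rewrite /qchar; do 2?[case: ifP => _]; [apply: Or31|apply: Or32|apply: Or33].
Qed.

Lemma qchar_eq0 x : (qchar x == 0) = (x == 0).
Proof. by rewrite /qchar; do 2?[case: ifP => //]. Qed.

Lemma qchar_sqr x : x != 0 -> qchar x * qchar x = 1.
Proof. by rewrite -qchar_eq0; case: (qchar_val x) => -> //; rewrite eqxx. Qed.

Hypothesis oddF : odd #|F|.
Let h := (#|F|.-1)./2.

Let hE : #|F|.-1 = h.*2.
Proof.
rewrite /h -[LHS]odd_double_half; move: (finNzRing_gt1 F) oddF.
by case: #|F| => //= n _ /negbTE ->.
Qed.

Let h_gt0 : (0 < h)%N.
Proof.
have : (0 < #|F|.-1)%N by rewrite -subn1 subn_gt0 finNzRing_gt1.
by rewrite hE double_gt0.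
Qed.

Lemma prim_root_half (z : F) : #|F|.-1.-primitive_root z -> z ^+ h = -1.
Proof.
move=> Hz; have : (z ^+ h) ^+ 2 == 1.
  by rewrite -exprM muln2 -hE (prim_expr_order Hz).
rewrite sqrf_eq1 => /orP[|/eqP //]; rewrite -(prim_order_dvd Hz).
by move=> /(dvdn_leq h_gt0); rewrite hE leqNgt -addnn -{1}[h]addn0 ltn_add2l h_gt0.
Qed.

Lemma finfield_oner_neqN1 : 1 != -1 :> F.
Proof.
have [z Hz] := finfield_prim_root; rewrite -(prim_root_half Hz) eq_sym.
rewrite -(prim_order_dvd Hz); apply/negP => /(dvdn_leq h_gt0).
by rewrite hE leqNgt -addnn -{1}[h]addn0 ltn_add2l h_gt0.
Qed.

(** Euler's criterion: a nonsquare is an odd power of a generator [z], and [z ^ h] is -1. *)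
Lemma qchar_euler x : x ^+ h = (qchar x)%:~R.
Proof.
rewrite /qchar; have [->|x0] := eqVneq x 0; first by rewrite expr0n gtn_eqF.
case: existsP => [[y /eqP Ey]|Hno].
  rewrite -Ey -exprM mul2n -hE finfield_expf_pred //.
  by apply: contraNneq x0 => y0; rewrite -Ey y0 expr0n.
have [z Hz] := finfield_prim_root.
have [i Ei] := prim_rootP Hz (finfield_expf_pred x0).
have [odd_i|even_i] := boolP (odd i).
  by rewrite Ei -exprM mulnC exprM (prim_root_half Hz) -signr_odd odd_i expr1.
case: Hno; exists (z ^+ i./2); rewrite -exprM muln2 Ei.
by rewrite -{2}(odd_double_half i) (negbTE even_i).
Qed.

Lemma qcharM x y : qchar (x * y) = qchar x * qchar y.
Proof.
apply: (sign_intr_inj finfield_oner_neqN1); first exact: qchar_val.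
  by case: (qchar_val x) => ->; case: (qchar_val y) => ->;
     rewrite ?(mul0r, mulr0, mul1r, mulr1, mulrNN);
     do ?[by apply: Or31 | by apply: Or32 | by apply: Or33].
by rewrite rmorphM /= -!qchar_euler exprMn.
Qed.

Lemma qchar1 : qchar 1 = 1.
Proof.
rewrite /qchar (negbTE (oner_neq0 F)); case: existsP => // -[].
by exists 1; rewrite expr1n.
Qed.

Lemma qchar_nonresidue : exists x, qchar x = -1.
Proof.
have [z Hz] := finfield_prim_root; exists z.
apply: (sign_intr_inj finfield_oner_neqN1); [exact: qchar_val | exact: Or33 |].
by rewrite -qchar_euler (prim_root_half Hz).
Qed.

Lemma qcharN1 : qchar (-1) = (-1) ^+ h.
Proof.
apply: (sign_intr_inj finfield_oner_neqN1); first exact: qchar_val.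
  by rewrite -signr_odd; case: odd; [apply: Or33 | apply: Or32].
by rewrite -qchar_euler rmorphXn /=.
Qed.

Lemma sum_qchar : \sum_x qchar x = 0.
Proof.
have [u Hu] := qchar_nonresidue.
have u0 : u != 0 by rewrite -qchar_eq0 Hu.
have E : \sum_x qchar x = - \sum_x qchar x.
  rewrite [LHS](reindex_inj (mulfI u0)) /= -sumrN; apply: eq_bigr => x _.
  by rewrite qcharM Hu mulN1r.
by lia.
Qed.

End QuadraticCharacter.

Definition legendre (p a : nat) : int := qchar (a%:R : 'F_p).

Section LegendreSymbol.
Variable p : nat.
Hypotheses (p_pr : prime p) (p_odd : odd p).

Let pFp : p \in [pchar 'F_p] := pchar_Fp p_pr.
Let oddFp : odd #|'F_p|. Proof. by rewrite card_Fp. Qed.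

Lemma legendre_val a :
  [\/ legendre p a = 0, legendre p a = 1 | legendre p a = -1].
Proof. exact: qchar_val. Qed.

Lemma legendreM a b : legendre p (a * b) = legendre p a * legendre p b.
Proof. by rewrite /legendre natrM qcharM. Qed.

Lemma legendre1 : legendre p 1 = 1.
Proof. exact: qchar1. Qed.

Lemma legendre_prod (s : seq nat) :
  legendre p (\prod_(q <- s) q)%N = \prod_(q <- s) legendre p q.
Proof.
elim: s => [|q s IHs]; first by rewrite !big_nil legendre1.
by rewrite !big_cons legendreM IHs.
Qed.

Lemma legendre_eq0 a : (legendre p a == 0) = (p %| a)%N.
Proof. by rewrite /legendre qchar_eq0 (dvdn_pcharf pFp). Qed.

Lemma legendre_mod a : legendre p (a %% p) = legendre p a.
Proof. by rewrite /legendre GRing.natr_mod_pchar. Qed.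

Lemma legendre_nonresidue : exists u, legendre p u = -1.
Proof.
have [x Hx] := qchar_nonresidue oddFp.
by exists (val x); rewrite /legendre natr_Zp.
Qed.

Lemma legendre_eq1 a : legendre p a = 1 -> exists x : nat, x ^ 2 = a %[mod p].
Proof.
rewrite /legendre /qchar; case: ifP => // _; case: existsP => // -[y /eqP Ey] _.
exists (val y); rewrite -!val_Fp_nat //; congr val.
by rewrite natrX natr_Zp.
Qed.

Lemma legendre_pred : legendre p p.-1 = (-1) ^+ p.-1./2.
Proof.
rewrite /legendre -[in RHS](card_Fp p_pr) -qcharN1 //; congr qchar.
by apply/eqP; rewrite -subr_eq0 opprK natr1 prednK ?prime_gt0 // pcharf0.
Qed.

(** Euler's criterion is a congruence between integers modulo [p], so it passes from ['F_p] to every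
    field of characteristic [p]. *)
Lemma legendre_euler (F : fieldType) a : p \in [pchar F] ->
  (a%:R : F) ^+ p.-1./2 = (legendre p a)%:~R.
Proof.
move=> pF; have h_gt0 : (0 < p.-1./2)%N.
  by have := odd_prime_gt2 p_odd p_pr; case: p => [|[|[|]]].
have [pa|pNa] := boolP (p %| a)%N.
  have /eqP -> : legendre p a == 0 by rewrite legendre_eq0.
  have /eqP -> : a%:R == 0 :> F by rewrite -(dvdn_pcharf pF).
  by rewrite expr0n gtn_eqF.
have Eul : (a%:R : 'F_p) ^+ p.-1./2 = (legendre p a)%:~R.
  by rewrite /legendre -qchar_euler // card_Fp.
have a_gt0 : (0 < a ^ p.-1./2)%N.
  by rewrite expn_gt0; case: a pNa {Eul} => //; rewrite dvdn0.
move: Eul; rewrite -!natrX; case: (legendre_val a) => E; rewrite E.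
- by move/eqP: E; rewrite legendre_eq0 (negbTE pNa).
- move/eqP; rewrite -subr_eq0 -(natrB _ a_gt0) -(dvdn_pcharf pFp).
  by rewrite (dvdn_pcharf pF) natrB // subr_eq0 => /eqP.
move/eqP; rewrite rmorphN /= -addr_eq0 natr1 -(dvdn_pcharf pFp).
by rewrite (dvdn_pcharf pF) -natr1 addr_eq0 => /eqP ->.
Qed.

End LegendreSymbol.

Lemma pchar_oner_neqN1 (F : fieldType) p : odd p -> p \in [pchar F] -> 1 != -1 :> F.
Proof.
move=> p_odd pF; rewrite -addr_eq0 -(dvdn_pcharf pF 2); apply/negP => dvd.
have := dvdn_leq (isT : 0 < 2)%N dvd.
by case: p p_odd pF {dvd} => [|[|[|]]] // _; rewrite inE.
Qed.

(** * Quadratic Gauss sums and reciprocity *)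

Section GaussSum.
Variables (q : nat) (F : fieldType) (z : F).
Hypotheses (q_pr : prime q) (q_odd : odd q) (Hz : q.-primitive_root z).

Let e (x : 'F_q) : F := z ^+ val x.
Let chi (x : 'F_q) : F := (qchar x)%:~R.
Let tau := \sum_x chi x * e x.
Let oddFq : odd #|'F_q|. Proof. by rewrite card_Fp. Qed.

Lemma root_charD x y : e (x + y) = e x * e y.
Proof.
rewrite /e /= -exprD; apply: expr_mod.
by rewrite Fp_cast // (prim_expr_order Hz).
Qed.

Lemma root_charMn x n : e (x *+ n) = e x ^+ n.
Proof. by elim: n => [|n IHn]; rewrite ?mulr0n // mulrS root_charD IHn exprS. Qed.

Lemma sum_root_char c : \sum_x e (c * x) = if c == 0 then q%:R else 0.
Proof.
case: eqVneq => [->|c0].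
  under eq_bigr do rewrite mul0r.
  by rewrite sumr_const card_Fp // /e expr0.
have <- : \sum_x e x = \sum_x e (c * x) by exact: (reindex_inj (mulfI c0)).
have e1 : e 1 != 1.
  rewrite /e [val _](val_Fp_nat q_pr 1) prim_expr_mod // expr1.
  by rewrite -[z]expr1 -(prim_order_dvd Hz) dvdn1 gtn_eqF ?prime_gt1.
have E : (\sum_x e x) * e 1 = \sum_x e x.
  rewrite mulr_suml [RHS](reindex_inj (addIr 1)) /=.
  by apply: eq_bigr => x _; rewrite root_charD.
by apply/eqP; apply: contraNT e1 => /mulfI inj; apply/eqP/inj; rewrite E mulr1.
Qed.

(** Substituting [y = c x] in the double sum leaves [chi c] times the sum of [e ((1 + c) x)] over
    nonzero [x], which is [q - 1] for [c = -1] and -1 otherwise; the terms [- chi c] add up to 0. *)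
Lemma gauss_sum_sqr : tau ^+ 2 = (qchar (-1 : 'F_q))%:~R * q%:R.
Proof.
have -> : tau ^+ 2 = \sum_x \sum_y chi x * chi y * e (x + y).
  rewrite expr2 /tau mulr_suml; apply: eq_bigr => x _; rewrite mulr_sumr.
  by apply: eq_bigr => y _; rewrite root_charD mulrACA.
rewrite (bigD1 0) //= big1 ?add0r => [|y _]; last by rewrite /chi qchar0 !mul0r.
have -> : \sum_(x | x != 0) \sum_y chi x * chi y * e (x + y) =
          \sum_(x | x != 0) \sum_c chi c * e ((1 + c) * x).
  apply: eq_bigr => x x0; rewrite (reindex_inj (mulfI x0)) /=.
  apply: eq_bigr => c _; rewrite /chi qcharM // -rmorphM /= mulrA qchar_sqr //.
  by rewrite mul1r mulrDl mul1r (mulrC c).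
rewrite exchange_big /=.
have -> : \sum_c \sum_(x | x != 0) chi c * e ((1 + c) * x) =
          \sum_c (chi c * (if 1 + c == 0 then q%:R else 0) - chi c).
  apply: eq_bigr => c _; rewrite -mulr_sumr -[X in _ - X]mulr1 -mulrBr.
  congr (_ * _); rewrite -sum_root_char [X in _ = X - _](bigD1 0) //= mulr0.
  by rewrite /e expr0 addrAC subrr add0r.
rewrite sumrB [X in _ - X](_ : _ = 0) ?subr0; last first.
  by rewrite /chi -rmorph_sum /= sum_qchar.
rewrite (bigD1 (-1)) //= subrr eqxx big1 ?addr0 // => c cN1.
by rewrite addrC addr_eq0 (negbTE cN1) mulr0.
Qed.

(** Frobenius fixes the values of [chi] and turns [e x] into [e (p x)]; a change of variable then
    produces the factor [chi p]. *)
Lemma gauss_sum_frobenius p : prime p -> odd p -> p \in [pchar F] ->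
  tau ^+ p = (legendre q p)%:~R * tau.
Proof.
move=> p_pr p_odd pF; rewrite -(pFrobenius_autE pF) /tau rmorph_sum /=.
have chip x : chi x ^+ p = chi x.
  rewrite /chi; case: (qchar_val x) => ->; rewrite ?rmorph0 ?rmorphN ?rmorph1 /=.
  - by rewrite expr0n gtn_eqF ?prime_gt0.
  - by rewrite expr1n.
  by rewrite -signr_odd p_odd expr1.
have p0 : p%:R != 0 :> 'F_q.
  apply: contraTneq (prime_gt1 q_pr) => p0.
  have qp : (q %| p)%N by rewrite (dvdn_pcharf (pchar_Fp q_pr)) p0.
  have Eqp : q = p by apply/eqP; rewrite -dvdn_prime2.
  have := prim_root_natf_neq0 Hz; rewrite Eqp (pcharf0 pF) eqxx //.
rewrite [in RHS](reindex_inj (mulfI p0)) mulr_sumr; apply: eq_bigr => x _.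
rewrite pFrobenius_autE exprMn chip mulrA; congr (_ * _).
  by rewrite /chi -rmorphM /= qcharM // mulrA qchar_sqr // mul1r.
by rewrite mulr_natl root_charMn.
Qed.

End GaussSum.

Lemma finfield_root_of_unity p k n : prime p -> (0 < k)%N -> (n %| (p ^ k).-1)%N ->
  exists (F : finFieldType) (z : F), p \in [pchar F] /\ n.-primitive_root z.
Proof.
move=> p_pr k_gt0 dvd; have [F pF cardF] := pPrimePowerField p_pr k_gt0.
have [z Hz] := finfield_prim_root F; exists F, (z ^+ (#|F|.-1 %/ n)).
by split=> //; apply: dvdn_prim_root; rewrite // cardF.
Qed.

(** In characteristic [p], [tau ^ p] is computed twice: by Frobenius, and by Euler's criterion as
    [(tau ^ 2) ^ ((p - 1) / 2) * tau]. Since [q] is 1 modulo 4, -1 is a square modulo [q] and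
    [tau ^ 2 = q] without sign. *)
Theorem quadratic_reciprocity_1mod4 p q : prime p -> odd p -> prime q ->
  (q %% 4 = 1)%N -> p != q -> legendre p q = legendre q p.
Proof.
move=> p_pr p_odd q_pr q4 pq.
have q_odd : odd q by rewrite -(odd_mod q (erefl : odd 4 = false)) q4.
have q1_gt0 : (0 < q.-1)%N by have := prime_gt1 q_pr; case: q {q_pr q4 pq q_odd} => [|[|]].
have cop : coprime p q by rewrite prime_coprime // dvdn_prime2.
have dvd : (q %| (p ^ q.-1).-1)%N.
  rewrite -subn1 -eqn_mod_dvd ?expn_gt0 ?prime_gt0 // -(totient_prime q_pr).
  by rewrite eq_sym Euler_exp_totient.
have [F [z [pF Hz]]] := finfield_root_of_unity p_pr q1_gt0 dvd.
pose tau := \sum_(x : 'F_q) (qchar x)%:~R * z ^+ val x.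
have Etau2 : tau ^+ 2 = q%:R.
  rewrite (gauss_sum_sqr q_pr q_odd Hz) qcharN1 ?card_Fp //.
  rewrite -signr_odd (_ : odd _ = false) ?mul1r //.
  by move: q4; clear; lia.
have q0 : q%:R != 0 :> F.
  by rewrite -(dvdn_pcharf pF) dvdn_prime2.
have tau0 : tau != 0 by apply: contraNneq q0 => t0; rewrite -Etau2 t0 expr0n.
apply: (sign_intr_inj (pchar_oner_neqN1 p_odd pF)) => //; try exact: legendre_val.
apply: (mulIf tau0); rewrite -(gauss_sum_frobenius q_pr q_odd Hz p_pr p_odd pF).
rewrite -(legendre_euler p_pr p_odd _ pF) -Etau2 -exprM mul2n.
have -> : (p.-1./2).*2 = p.-1.
  by rewrite -[RHS]odd_double_half; case: p p_odd {p_pr pq cop dvd pF} => //= n /negbTE ->.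
by rewrite -exprSr prednK // prime_gt0.
Qed.

(** * The characters modulo 4 and 8 *)

Definition chi4 (n : nat) : int := nth 0 [:: 0; 1; 0; -1] (n %% 4).
Definition chi8 (n : nat) : int := nth 0 [:: 0; 1; 0; -1; 0; -1; 0; 1] (n %% 8).

Lemma chi4M m n : chi4 (m * n) = chi4 m * chi4 n.
Proof.
rewrite /chi4 -modnMm; have := ltn_pmod m (isT : 0 < 4)%N.
have := ltn_pmod n (isT : 0 < 4)%N; move: (m %% 4)%N (n %% 4)%N.
by move=> [|[|[|[|//]]]] [|[|[|[|//]]]].
Qed.

Lemma chi8M m n : chi8 (m * n) = chi8 m * chi8 n.
Proof.
rewrite /chi8 -modnMm; have := ltn_pmod m (isT : 0 < 8)%N.
have := ltn_pmod n (isT : 0 < 8)%N; move: (m %% 8)%N (n %% 8)%N.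
by move=> [|[|[|[|[|[|[|[|//]]]]]]]] [|[|[|[|[|[|[|[|//]]]]]]]].
Qed.

Lemma chi4_val n : [\/ chi4 n = 0, chi4 n = 1 | chi4 n = -1].
Proof.
rewrite /chi4; have := ltn_pmod n (isT : 0 < 4)%N; move: (n %% 4)%N.
by move=> [|[|[|[|//]]]] _; [apply: Or31|apply: Or32|apply: Or31|apply: Or33].
Qed.

Lemma chi8_val n : [\/ chi8 n = 0, chi8 n = 1 | chi8 n = -1].
Proof.
rewrite /chi8; have := ltn_pmod n (isT : 0 < 8)%N; move: (n %% 8)%N.
by move=> [|[|[|[|[|[|[|[|//]]]]]]]] _;
   do ?[by apply: Or31 | by apply: Or32 | by apply: Or33].
Qed.

Lemma legendre_pred_chi4 p : prime p -> odd p -> legendre p p.-1 = chi4 p.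
Proof.
move=> p_pr p_odd; rewrite legendre_pred // -signr_odd /chi4.
have : (p %% 4 = 1 /\ odd p.-1./2 = false \/ p %% 4 = 3 /\ odd p.-1./2)%N by lia.
by case=> -[-> ->].
Qed.

(** For a primitive eighth root of unity [z] in characteristic [p], [y = z + z ^ 7] satisfies
    [y ^ 2 = 2]; Frobenius maps it to [y] or [- y] according to [p] modulo 8. *)
Lemma legendre_2 p : prime p -> odd p -> legendre p 2 = chi8 p.
Proof.
move=> p_pr p_odd.
have dvd : (8 %| (p ^ 2).-1)%N.
  have Ep : p = (p./2).*2.+1 by rewrite -[LHS]odd_double_half p_odd.
  have -> : ((p ^ 2).-1 = 4 * (p./2 * (p./2).+1))%N by rewrite {1}Ep; lia.
  by rewrite (_ : 8 = 4 * 2)%N // dvdn_pmul2l // dvdn2 oddM /=; case: odd.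
have [F [z [pF Hz]]] := finfield_root_of_unity p_pr (isT : 0 < 2)%N dvd.
have z8 := prim_expr_order Hz.
have z4 : z ^+ 4 = -1.
  have : (z ^+ 4) ^+ 2 == 1 by rewrite -exprM z8.
  by rewrite sqrf_eq1 => /orP[|/eqP //]; rewrite -(prim_order_dvd Hz).
pose y := z + z ^+ 7.
have Ey2 : y ^+ 2 = 2%:R.
  have -> : y ^+ 2 = z ^+ 2 * (1 + z ^+ 4 * z ^+ 8) + 2%:R * z ^+ 8 by rewrite /y; ring.
  by rewrite z8 z4 !mulr1 subrr mulr0 add0r.
have two0 : 2%:R != 0 :> F.
  by have := pchar_oner_neqN1 p_odd pF; rewrite -addr_eq0.
have y0 : y != 0 by apply: contraNneq two0 => t0; rewrite -Ey2 t0 expr0n.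
apply: (sign_intr_inj (pchar_oner_neqN1 p_odd pF)); [exact: legendre_val|exact: chi8_val|].
apply: (mulfI y0); rewrite -(legendre_euler p_pr p_odd _ pF) -Ey2 -exprM mul2n.
have -> : (p.-1./2).*2 = p.-1.
  by rewrite -[RHS]odd_double_half; case: p p_odd {p_pr dvd pF} => //= n /negbTE ->.
rewrite -exprS prednK ?prime_gt0 // -(pFrobenius_autE pF) rmorphD /=.
rewrite !pFrobenius_autE -exprM mulnC exprM -(prim_expr_mod Hz p) /chi8 /y.
have z5 : z ^+ 5 = - z by rewrite exprS z4 mulrN1.
have z3 : z ^+ 3 = - z ^+ 7 by rewrite (exprD z 4 3) z4 mulN1r opprK.
have : (p %% 8 = 1 \/ p %% 8 = 3 \/ p %% 8 = 5 \/ p %% 8 = 7)%N by lia.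
have red n : z ^+ n = z ^+ (n %% 8) by rewrite prim_expr_mod.
case=> [->|[->|[->|->]]]; rewrite -?exprM /= ?expr1.
- by rewrite mulr1.
- by rewrite (red (3 * 7)%N) z5 z3 rmorphN mulrN1 opprD addrC.
- by rewrite (red (5 * 7)%N) z5 z3 rmorphN mulrN1 opprD.
by rewrite (red (7 * 7)%N) expr1 mulr1 addrC.
Qed.

(** * The three squares theorem *)

Section ChineseRemainder.
Local Open Scope nat_scope.

Lemma coprime_prod_seq (s : seq nat) m :
  {in s, forall q, coprime q m} -> coprime (\prod_(q <- s) q) m.
Proof.
move=> H; rewrite big_seq; apply: (big_ind (fun x => coprime x m)) => //.
- exact: coprime1n.
- by move=> x y Hx Hy; rewrite coprimeMl Hx.
Qed.

Lemma modn_eq_dvd u v m d : d %| m -> u = v %[mod m] -> u = v %[mod d].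
Proof. by move=> dm E; rewrite -(modn_dvdm u dm) E modn_dvdm. Qed.

Lemma coprime_primes_prod p (s : seq nat) :
  prime p -> all prime s -> p \notin s -> coprime (\prod_(q <- s) q) p.
Proof.
move=> p_pr /allP s_pr pNs; apply: coprime_prod_seq => q qs.
have q_pr := s_pr q qs; rewrite prime_coprime // dvdn_prime2 //.
by apply: contraNneq pNs => <-.
Qed.

Lemma dvdn_prod_mem (s : seq nat) p : p \in s -> p %| \prod_(q <- s) q.
Proof. by move=> ps; rewrite (big_rem p) //= dvdn_mulr. Qed.

Lemma chinese_seq (s : seq nat) (r : nat -> nat) r0 :
    uniq s -> all prime s -> all odd s ->
  exists u, u = r0 %[mod 8] /\ {in s, forall p, u = r p %[mod p]}.
Proof.
elim: s => [|p s IHs] /=; first by exists r0.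
case/andP=> pNs us /andP[p_pr s_pr] /andP[p_odd s_odd].
have [u [u8 us']] := IHs us s_pr s_odd.
have cop : coprime (8 * \prod_(q <- s) q) p.
  rewrite coprimeMl coprime_primes_prod // andbT (_ : 8 = 2 ^ 3) //.
  by rewrite coprimeXl // coprime2n.
exists (chinese (8 * \prod_(q <- s) q) p u (r p)).
have E1 := chinese_modl cop u (r p); split.
  by rewrite -u8; apply: modn_eq_dvd E1; rewrite dvdn_mulr.
move=> q; rewrite inE => /orP[/eqP ->|qs]; first exact: chinese_modr.
rewrite -us' //; apply: modn_eq_dvd E1.
by rewrite dvdn_mull // dvdn_prod_mem.
Qed.

Lemma prod_primes_dvdn (s : seq nat) x :
  uniq s -> all prime s -> {in s, forall p, p %| x} -> \prod_(p <- s) p %| x.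
Proof.
elim: s => [|p s IHs] /=; first by rewrite big_nil dvd1n.
case/andP=> pNs us /andP[p_pr s_pr] H; rewrite big_cons Gauss_dvd.
  by rewrite H ?mem_head // IHs // => q qs; rewrite H // inE qs orbT.
by rewrite coprime_sym coprime_primes_prod.
Qed.

Lemma odd_prod_seq (s : seq nat) : all odd s -> odd (\prod_(p <- s) p).
Proof.
by elim: s => [|p s IHs] /=; rewrite ?big_nil // big_cons oddM => /andP[-> /IHs].
Qed.

End ChineseRemainder.

(** * Primes with prescribed residue symbols *)

Section PrimeWithResidues.
Variable ps : seq nat.
Hypotheses (ps_uniq : uniq ps) (ps_pr : all prime ps) (ps_odd : all odd ps).

Let R : realType := Rdefinitions.R.
Let I : finType := option (option 'I_(size ps)).
Let P (i : 'I_(size ps)) : nat := nth 0%N ps i.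
Let chi (i : I) (n : nat) : int :=
  match i with
  | None => chi4 n
  | Some None => chi8 n
  | Some (Some i) => legendre (P i) n
  end.
Let N : nat := (8 * \prod_(p <- ps) p)%N.

Let P_mem i : P i \in ps. Proof. exact: mem_nth. Qed.
Let P_pr i : prime (P i). Proof. exact: (allP ps_pr). Qed.
Let P_odd i : odd (P i). Proof. exact: (allP ps_odd). Qed.
Let P_dvdN i : (P i %| N)%N. Proof. by rewrite dvdn_mull ?dvdn_prod_mem. Qed.
Let N_gt0 : (0 < N)%N.
Proof.
rewrite muln_gt0 big_seq prodn_cond_gt0 // => p pps.
by rewrite prime_gt0 // (allP ps_pr).
Qed.

Let chiM i m n : chi i (m * n)%N = chi i m * chi i n.
Proof. by case: i => [[i|]|] /=; rewrite ?legendreM ?chi4M ?chi8M. Qed.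

Let chi1 i : chi i 1%N = 1.
Proof. by case: i => [[i|]|] //=; rewrite legendre1. Qed.

Let chi_per i n : chi i (n + N)%N = chi i n.
Proof.
case: i => [[i|]|] /=.
- rewrite -legendre_mod // -[RHS]legendre_mod //; congr legendre.
  by rewrite -modnDmr (eqP (P_dvdN i)) addn0.
- by rewrite /chi8 /N addnC mulnC modnMDl.
by rewrite /chi4 /N; congr nth; lia.
Qed.

Let chi_val i n : [\/ chi i n = 0, chi i n = 1 | chi i n = -1].
Proof.
by case: i => [[i|]|] /=; [exact: legendre_val|exact: chi8_val|exact: chi4_val].
Qed.

Let chi_unit i n : coprime n N -> chi i n != 0.
Proof.
rewrite coprimeMr => /andP[n8 cop].
have n_odd : odd n by move: n8; rewrite (_ : 8 = 2 ^ 3)%N // coprime_pexpr // coprimen2.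
case: i => [[i|]|] /=.
- rewrite legendre_eq0 //; apply/negP => dvd.
  have := coprime_dvdl dvd cop; rewrite prime_coprime //.
  by rewrite dvdn_prod_mem.
- rewrite /chi8; have : odd (n %% 8) by rewrite odd_mod.
  have := ltn_pmod n (isT : 0 < 8)%N; move: (n %% 8)%N.
  by move=> [|[|[|[|[|[|[|[|//]]]]]]]].
rewrite /chi4; have : odd (n %% 4) by rewrite odd_mod.
have := ltn_pmod n (isT : 0 < 4)%N; move: (n %% 4)%N.
by move=> [|[|[|[|//]]]].
Qed.

Let coprime_of_residues u : odd u -> {in ps, forall p, ~~ (p %| u)%N} -> coprime u N.
Proof.
move=> u_odd H; rewrite coprime_sym /N coprimeMl (_ : 8 = 2 ^ 3)%N //.
rewrite coprimeXl ?coprime2n //=; apply: coprime_prod_seq => p pps.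
by rewrite prime_coprime ?(allP ps_pr) // H.
Qed.

Let not_dvd1 p : p \in ps -> ~~ (p %| 1)%N.
Proof. by move=> pps; rewrite dvdn1 gtn_eqF // prime_gt1 // (allP ps_pr). Qed.

(** The Chinese remainder theorem prescribes [u] modulo 8 and modulo each prime; a Legendre symbol
    is singled out by a nonresidue at its prime and 1 elsewhere. *)
Let chi_indep i : exists u,
  [/\ coprime u N, chi i u = -1 & forall j, j != i -> chi j u = 1].
Proof.
have dvd_mod u p r : u = r %[mod p] -> (p %| u)%N = (p %| r)%N by rewrite /dvdn => ->.
have odd8 u r : u = r %[mod 8] -> odd u = odd r.
  by move=> E; rewrite -(odd_mod u (erefl : odd 8 = false)) E odd_mod.
have Chi8 u r : u = r %[mod 8] -> chi8 u = chi8 r by rewrite /chi8 => ->.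
have Chi4 u r : u = r %[mod 8] -> chi4 u = chi4 r.
  by move=> E; rewrite /chi4 -(@modn_dvdm 8) // E modn_dvdm.
have Leg j u r : u = r %[mod P j] -> legendre (P j) u = legendre (P j) r.
  by move=> E; rewrite -legendre_mod // E legendre_mod.
have simple r0 : odd r0 -> exists u,
    [/\ coprime u N, chi4 u = chi4 r0, chi8 u = chi8 r0 &
        forall j, legendre (P j) u = 1].
  move=> r0_odd; have [u [u8 up]] := chinese_seq (fun=> 1%N) r0 ps_uniq ps_pr ps_odd.
  exists u; split; [|exact: Chi4|exact: Chi8|].
    apply: coprime_of_residues; first by rewrite (odd8 _ _ u8).
    by move=> p pps; rewrite (dvd_mod _ _ _ (up p pps)) not_dvd1.
  by move=> j; rewrite (Leg _ _ _ (up _ (P_mem j))) legendre1.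
case: i => [[i|]|].
- have [v Ev] := legendre_nonresidue (P_pr i) (P_odd i).
  pose r p := if p == P i then v else 1%N.
  have [u [u8 up]] := chinese_seq r 1 ps_uniq ps_pr ps_odd.
  exists u; split.
  + apply: coprime_of_residues; first by rewrite (odd8 _ _ u8).
    move=> p pps; rewrite (dvd_mod _ _ _ (up p pps)) /r.
    case: eqP => [->|_]; last exact: not_dvd1.
    by rewrite -legendre_eq0 // Ev.
  + by rewrite /= (Leg _ _ _ (up _ (P_mem i))) /r eqxx.
  case=> [[j|]|] ji /=; last by rewrite (Chi4 _ _ u8).
    rewrite (Leg _ _ _ (up _ (P_mem j))) /r; case: eqP => [Ej|_]; last by rewrite legendre1.
    case/negP: ji; apply/eqP; congr (Some (Some _)); apply/val_inj/eqP.
    by rewrite /= -(nth_uniq 0%N _ _ ps_uniq) // -/(P j) Ej.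
  by rewrite (Chi8 _ _ u8).
(* The residue 5 has [chi4 = 1] and [chi8 = -1]; the residue 7, used next, has [chi4 = -1] and
   [chi8 = 1]. *)
- have [u [cop u4 u8 uP]] := simple 5%N isT; exists u; split=> //.
  by case=> [[j|]|] //=.
have [u [cop u4 u8 uP]] := simple 7%N isT; exists u; split=> //.
by case=> [[j|]|] //=.
Qed.

Lemma prime_with_residues (s : nat -> int) (t : int) :
    {in ps, forall p, s p = 1 \/ s p = -1} -> t = 1 \/ t = -1 ->
  exists q, [/\ prime q, (q %% 4 = 1)%N, chi8 q = t &
                {in ps, forall p, legendre p q = s p}].
Proof.
move=> Hs Ht.
pose eps (i : I) := match i with
  | None => false | Some None => t == -1 | Some (Some i) => s (P i) == -1 end.
have [q [q_pr Hq]] := @prime_with_signs R I chi N N_gt0 chiM chi1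
  chi_per chi_val chi_unit chi_indep eps.
exists q; split=> //.
- have := Hq None; rewrite /= /chi4; have := ltn_pmod q (isT : 0 < 4)%N.
  by move: (q %% 4)%N => [|[|[|[|//]]]].
- by have := Hq (Some None); rewrite /= => ->; case: Ht => ->.
move=> p pps; have lt : (index p ps < size ps)%N by rewrite index_mem.
have := Hq (Some (Some (Ordinal lt))); rewrite /= /P /= nth_index // => ->.
by case: (Hs _ pps) => ->.
Qed.

End PrimeWithResidues.

Section ThreeSquares.

Lemma sum3_of_dvdn (n m b s : nat) : (0 < n)%N -> (0 < m)%N ->
  (m %| b ^ 2 + n)%N -> (n %| s ^ 2 * m + 1)%N -> sum_three_squares n%:Z.
Proof.
move=> n0 m0 /dvdnP[h Eh] /dvdnP[w Ew].
apply: (@sum3_of_residues n%:Z m%:Z b%:Z h%:Z s%:Z w%:Z) => //.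
- by rewrite mulrC -PoszM -Eh PoszD; congr (_ + _); rewrite !expr2 mulnn.
by rewrite -PoszM -Ew PoszD PoszM; congr (_ * _ + _); rewrite expr2 mulnn.
Qed.

(** The hypothesis says that [- m] is a square modulo each [p], with [p.-1] in the role of -1. Then
    [s] is glued from the quotients [x / m] with [x ^ 2 = - m], and is taken 1 modulo 8 so as to be
    odd. *)
Lemma exists_inverse_root (ps : seq nat) m :
    uniq ps -> all prime ps -> all odd ps ->
    {in ps, forall p, legendre p (m * p.-1) = 1} ->
  exists s, odd s /\ (\prod_(p <- ps) p %| s ^ 2 * m + 1)%N.
Proof.
move=> us pr od H.
have loc p : exists s, p \in ps -> (p %| s ^ 2 * m + 1)%N.
  have [pps|_] := boolP (p \in ps); last by exists 0%N.
  have p_pr := allP pr p pps; have pF := pchar_Fp p_pr.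
  have [x Ex] := legendre_eq1 p_pr (H p pps).
  have m0 : m%:R != 0 :> 'F_p.
    rewrite -(dvdn_pcharf pF); apply/negP => dvd.
    have : legendre p (m * p.-1) == 0 by rewrite legendre_eq0 // dvdn_mulr.
    by rewrite H.
  have Ex' : x%:R ^+ 2 = - m%:R :> 'F_p.
    rewrite -natrX -(GRing.natr_mod_pchar pF) Ex (GRing.natr_mod_pchar pF) natrM.
    rewrite -[RHS]mulr1 -mulrN1 -mulrA; congr (_ * _); rewrite mulr1.
    apply/eqP; rewrite -subr_eq0 opprK natr1 prednK ?prime_gt0 //.
    by rewrite pcharf0.
  exists (val (x%:R / m%:R : 'F_p)) => _.
  rewrite (dvdn_pcharf pF) natrD natrM natrX natr_Zp expr_div_n Ex'.
  by apply/eqP; field.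
have [r Hr] := choice loc.
have [s [s8 sp]] := chinese_seq r 1 us pr od; exists s; split.
  by rewrite -(odd_mod s (erefl : odd 8 = false)) s8.
apply: prod_primes_dvdn => // p pps; rewrite /dvdn -modnDml -modnMml -modnXm sp //.
by rewrite modnXm modnMml modnDml; exact: Hr.
Qed.

Lemma chi4_prod (s : seq nat) : chi4 (\prod_(p <- s) p) = \prod_(p <- s) chi4 p.
Proof. by elim: s => [|p s IHs]; rewrite ?big_nil // !big_cons chi4M IHs. Qed.

Lemma chi8_prod (s : seq nat) : chi8 (\prod_(p <- s) p) = \prod_(p <- s) chi8 p.
Proof. by elim: s => [|p s IHs]; rewrite ?big_nil // !big_cons chi8M IHs. Qed.

Lemma chi4_odd n : odd n -> chi4 n = 1 \/ chi4 n = -1.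
Proof.
move=> n_odd; rewrite /chi4; have : odd (n %% 4) by rewrite odd_mod.
have := ltn_pmod n (isT : 0 < 4)%N; move: (n %% 4)%N.
by move=> [|[|[|[|//]]]] //= _ _; [left|right].
Qed.

Lemma chi8_odd n : odd n -> chi8 n = 1 \/ chi8 n = -1.
Proof.
move=> n_odd; rewrite /chi8; have : odd (n %% 8) by rewrite odd_mod.
have := ltn_pmod n (isT : 0 < 8)%N; move: (n %% 8)%N.
by move=> [|[|[|[|[|[|[|[|//]]]]]]]] //= _ _; do ?[by left | by right].
Qed.

Lemma legendre_reciprocal_prod (ps : seq nat) q (s : nat -> int) :
    all prime ps -> all odd ps -> prime q -> (q %% 4 = 1)%N ->
    {in ps, forall p, legendre p q = s p} -> {in ps, forall p, s p != 0} ->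
  legendre q (\prod_(p <- ps) p) = \prod_(p <- ps) s p.
Proof.
move=> pr od q_pr q4 Hs s0; rewrite legendre_prod //; last by lia.
rewrite big_seq [RHS]big_seq; apply: eq_bigr => p pps.
have p_pr : prime p := allP pr p pps; have p_odd : odd p := allP od p pps.
have sp0 : s p != 0 := s0 p pps.
have pq : p != q.
  by apply: contraNneq sp0 => Epq; rewrite -Hs // legendre_eq0 // Epq.
by rewrite -(quadratic_reciprocity_1mod4 p_pr p_odd q_pr q4 pq) Hs.
Qed.

Lemma legendre_neg_root q n : prime q -> (q %% 4 = 1)%N -> legendre q n = 1 ->
  exists b, (q %| b ^ 2 + n)%N.
Proof.
move=> q_pr q4 Hn; have q_odd : odd q by lia.
have : legendre q (n * q.-1) = 1.
  by rewrite legendreM // Hn mul1r legendre_pred_chi4 // /chi4 q4.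
case/(legendre_eq1 q_pr) => b Eb; exists b.
rewrite /dvdn -modnDml Eb modnDml -mulnSr prednK ?prime_gt0 //.
by rewrite modnMl.
Qed.

(* The auxiliary prime [q] is used with [m = q], except for [n = 3 mod 8] where
   [m = 2 q]. *)
Lemma sum3_squarefree (ps : seq nat) (two : bool) (n := (2 ^ two * \prod_(p <- ps) p)%N) :
    uniq ps -> all prime ps -> all odd ps -> (n %% 8 != 7)%N ->
  sum_three_squares n%:Z.
Proof.
move=> us pr od; pose P := (\prod_(p <- ps) p)%N.
have P_odd : odd P := odd_prod_seq od.
have P_gt0 : (0 < P)%N by exact: odd_gt0.
have s4 : {in ps, forall p, chi4 p = 1 \/ chi4 p = -1}.
  by move=> p pps; apply: chi4_odd; exact: (allP od).
have pm0 (x : int) : x = 1 \/ x = -1 -> x != 0 by case=> ->.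
have pmM (x : int) : x = 1 \/ x = -1 -> x * x = 1 by case=> ->.
have leg_pred p : p \in ps -> legendre p p.-1 = chi4 p.
  by move=> pps; rewrite legendre_pred_chi4 ?(allP pr) ?(allP od).
have legM p a b : p \in ps -> legendre p (a * b) = legendre p a * legendre p b.
  by move=> pps; rewrite legendreM ?(allP pr) ?(allP od).
case: two @n => n; rewrite /n [nat_of_bool _]/= ?expn1 ?expn0 -/P => n7.
(* For [n = 2 P], [(q / p) = (-1 / p)] makes [- q] a square modulo each [p], and [(2 / q) = chi4 P]
   makes [2 P] a square modulo [q]. *)
- have [q [q_pr q4 q8 Hq]] := prime_with_residues us pr od s4 (chi4_odd P_odd).
  have q_odd : odd q by lia.
  have leg2P : legendre q (2 * P) = 1.
    rewrite legendreM // legendre_2 // q8.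
    rewrite (legendre_reciprocal_prod pr od q_pr q4 Hq) => [|p pps]; last exact/pm0/s4.
    by rewrite -chi4_prod pmM //; exact: chi4_odd.
  have [b Hb] := legendre_neg_root q_pr q4 leg2P.
  have [|s [s_odd Hs]] := @exists_inverse_root ps q us pr od.
    by move=> p pps; rewrite legM // Hq // leg_pred // pmM //; exact: s4.
  have Hs2 : (2 * P %| s ^ 2 * q + 1)%N.
    by rewrite Gauss_dvd ?coprime2n // Hs andbT dvdn2 oddD oddM oddX s_odd q_odd.
  apply: (@sum3_of_dvdn _ q b s) => //; last exact: prime_gt0.
  by rewrite muln_gt0.
rewrite mul1n in n7 *.
have [P1|P3] : (P %% 4 = 1 \/ P %% 8 = 3)%N by lia.
  (* For [P = 1] modulo 4 the symbols [(q / p) = (-1 / p)] still work, since the product of the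
     [chi4 p] is 1. *)
  have [q [q_pr q4 q8 Hq]] := prime_with_residues us pr od s4 (or_introl (erefl 1)).
  have legP : legendre q P = 1.
    rewrite (legendre_reciprocal_prod pr od q_pr q4 Hq) => [|p pps]; last exact/pm0/s4.
    by rewrite -chi4_prod /chi4 -/P P1.
  have [b Hb] := legendre_neg_root q_pr q4 legP.
  have [|s [s_odd Hs]] := @exists_inverse_root ps q us pr od.
    by move=> p pps; rewrite legM // Hq // leg_pred // pmM //; exact: s4.
  by apply: (@sum3_of_dvdn _ q b s) => //; rewrite ?prime_gt0.
(* For [P = 3] modulo 8, [(q / p) = (-2 / p)] makes [-2 q] a square modulo each [p], and the product
   of these symbols is [chi4 P * chi8 P = 1]. *)
have s48 : {in ps, forall p, chi4 p * chi8 p = 1 \/ chi4 p * chi8 p = -1}.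
  move=> p pps; have p_odd := allP od p pps.
  by case: (chi4_odd p_odd) => ->; case: (chi8_odd p_odd) => ->;
     rewrite ?mulrNN ?mulr1 ?mul1r; do ?[by left | by right].
have [q [q_pr q4 q8 Hq]] := prime_with_residues us pr od s48 (or_introl (erefl 1)).
have q_odd : odd q by lia.
have legP : legendre q P = 1.
  rewrite (legendre_reciprocal_prod pr od q_pr q4 Hq) => [|p pps]; last exact/pm0/s48.
  rewrite big_split /= -chi4_prod -chi8_prod -/P /chi4 /chi8 P3.
  by rewrite (_ : P %% 4 = 3)%N //; lia.
have [b0 Hb0] := legendre_neg_root q_pr q4 legP.
(* The modulus [2 q] needs [b ^ 2 + P] even; adding the odd [q] to [b0] corrects its parity. *)
have [b [b_odd Hb]] : exists b, odd b /\ (q %| b ^ 2 + P)%N.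
  have [ob|eb] := boolP (odd b0); first by exists b0.
  exists (b0 + q)%N; split; first by rewrite oddD (negbTE eb) q_odd.
  by rewrite /dvdn -modnDml -modnXm modnDr modnXm modnDml; exact: Hb0.
have [|s [s_odd Hs]] := @exists_inverse_root ps (2 * q)%N us pr od.
  move=> p pps; rewrite !legM // Hq // leg_pred // legendre_2 ?(allP pr) ?(allP od) //.
  rewrite -[RHS](pmM (chi4 p * chi8 p)); last exact: s48.
  by ring.
apply: (@sum3_of_dvdn _ (2 * q)%N b s) => //; rewrite ?muln_gt0 ?prime_gt0 //.
by rewrite Gauss_dvd ?coprime2n // Hb andbT dvdn2 oddD oddX b_odd P_odd.
Qed.

Lemma squarefree_decomposition n : (0 < n)%N -> exists c s,
  [/\ uniq s, all prime s, (0 < c)%N & n = (c ^ 2 * \prod_(p <- s) p)%N].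
Proof.
have [k] := ubnP n; elim: k n => // k IHk n ltnk n_gt0.
have [n_le1|n_gt1] := leqP n 1.
  by exists 1%N, [::]; rewrite big_nil; split=> //; lia.
have p_pr := pdiv_prime n_gt1; set p := pdiv n in p_pr.
have [n1 En] := dvdnP (pdiv_dvd n); rewrite mulnC -/p in En.
have n1_gt0 : (0 < n1)%N by move: n_gt0; rewrite En muln_gt0 => /andP[].
have ltn1 : (n1 < k)%N.
  by apply: leq_trans (ltnSE ltnk); rewrite En ltn_Pmull ?prime_gt1.
have [c [s [us pr c0 E1]]] := IHk n1 ltn1 n1_gt0.
have [ps|pNs] := boolP (p \in s).
  exists (c * p)%N, (rem p s); split; rewrite ?rem_uniq ?muln_gt0 ?c0 ?prime_gt0 //.
    by apply/allP => q /mem_rem; exact: (allP pr).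
  by rewrite En E1 (big_rem p) //= expnMn; ring.
exists c, (p :: s); split; rewrite //= ?pNs ?us ?p_pr //.
by rewrite En E1 big_cons; ring.
Qed.

Lemma sum_three_squares_scale (c n : nat) :
  sum_three_squares n%:Z -> sum_three_squares (c ^ 2 * n)%N%:Z.
Proof.
case=> x [y [z E]]; exists (c%:Z * x), (c%:Z * y), (c%:Z * z).
by rewrite !exprMn -!mulrDr -E -mulnn !PoszM expr2.
Qed.

Lemma sum_three_squares_nat (n : nat) : sum_three_squares n%:Z ->
  exists a b c : nat, n = (a ^ 2 + b ^ 2 + c ^ 2)%N.
Proof.
case=> a [b [c E]]; exists `|a|%N, `|b|%N, `|c|%N.
have abs2 (x : int) : (`|x| ^ 2)%N%:Z = x ^+ 2.
  by rewrite -mulnn PoszM -normrM -expr2 ger0_norm ?sqr_ge0.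
by apply/eqP; rewrite -eqz_nat !PoszD !abs2 E.
Qed.

(** Descent on [a]: three squares with sum divisible by 4 are all even. For [a = 0], squares are 0,
    1 or 4 modulo 8. *)
Lemma four_pow_8b7_not_sum3 a u : (u %% 8 = 7)%N ->
  ~ sum_three_squares (4 ^ a * u)%N%:Z.
Proof.
move=> u7 /sum_three_squares_nat; elim: a => [|a IHa] [x [y [z E]]].
  have sq v : (v ^ 2 %% 8 = 0 \/ v ^ 2 %% 8 = 1 \/ v ^ 2 %% 8 = 4)%N.
    rewrite -modnXm; have := ltn_pmod v (isT : 0 < 8)%N; move: (v %% 8)%N.
    by move=> [|[|[|[|[|[|[|[|//]]]]]]]] _ /=; auto.
  by move: (sq x) (sq y) (sq z) u7 E; rewrite mul1n; lia.
have sq v : (v ^ 2 %% 4 = odd v)%N.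
  by rewrite -(odd_mod v (erefl : odd 4 = false)) -modnXm; have := ltn_pmod v (isT : 0 < 4)%N;
     move: (v %% 4)%N; move=> [|[|[|[|//]]]].
have ev : ~~ odd x /\ ~~ odd y /\ ~~ odd z.
  have : ((x ^ 2 + y ^ 2 + z ^ 2) %% 4 = 0)%N by rewrite -E expnS -mulnA modnMr.
  by move: (sq x) (sq y) (sq z); case: (odd x); case: (odd y); case: (odd z) => /=; lia.
apply: IHa; exists x./2, y./2, z./2.
have half v : ~~ odd v -> (v ^ 2 = 4 * (v./2) ^ 2)%N.
  by move=> ev'; rewrite -{1}(odd_double_half v) (negbTE ev') add0n -mul2n expnMn.
move: E; rewrite (half x) ?(half y) ?(half z); try by case: ev => [? []].
by rewrite expnS -!mulnA -!mulnDr => /eqP; rewrite eqn_pmul2l // => /eqP.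
Qed.

Theorem legendre_three_squares n : (0 < n)%N ->
  sum_three_squares n%:Z <-> ~~ (~~ odd (logn 2 n) && (n`_2^' %% 8 == 7))%N.
Proof.
move=> n_gt0; split=> [H|Hn].
  apply/negP => /andP[ev /eqP u7]; move: H.
  rewrite -(partnC 2%N n_gt0) p_part.
  have -> : (2 ^ logn 2 n = 4 ^ (logn 2 n)./2)%N.
    by rewrite (_ : 4 = 2 ^ 2)%N // -expnM mul2n -{1}(odd_double_half (logn 2 n)) (negbTE ev).
  exact: four_pow_8b7_not_sum3.
have [c [s [us pr c0 En]]] := squarefree_decomposition n_gt0.
rewrite En; apply: sum_three_squares_scale.
pose ps := [seq p <- s | odd p].
have Es : (\prod_(p <- s) p = 2 ^ (2%N \in s) * \prod_(p <- ps) p)%N.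
  rewrite (bigID odd) /= mulnC; congr (_ * _)%N; last by rewrite /ps big_filter.
  have [s2|sN2] := boolP (2%N \in s).
    rewrite big_mkcond (bigD1_seq 2%N) //= big1_seq // => p /andP[p2 ps'].
    case: ifP => // ep; have /even_prime[E|] := allP pr p ps'.
      by rewrite E in p2.
    by rewrite (negbTE ep).
  rewrite big1_seq // => p /andP[ep ps'].
  have /even_prime[E|] := allP pr p ps'; first by rewrite -E ps' in sN2.
  by rewrite (negbTE ep).
rewrite Es; apply: sum3_squarefree.
- exact: filter_uniq.
- by apply/allP => p; rewrite mem_filter => /andP[_]; exact: (allP pr).
- by apply/allP => p; rewrite mem_filter => /andP[].
(* If the squarefree part is 7 modulo 8, it is odd, so [n] has even valuation; the odd part of
   [c ^ 2] is 1 modulo 8, so that of [n] is 7: the excluded case. *)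
rewrite -Es; apply: contra Hn => m7.
set m := (\prod_(p <- s) p)%N in m7 En.
have m_odd : odd m by rewrite -(odd_mod m (erefl : odd 8 = false)) (eqP m7).
have m_gt0 : (0 < m)%N by exact: odd_gt0.
have c2_gt0 : (0 < c ^ 2)%N by rewrite expn_gt0 c0.
rewrite En lognM // lognX [logn 2 m]logn_coprime ?coprime2n // addn0 oddM /=.
rewrite partnM // partnX [(m`__)%N]part_pnat_id -?odd_2'nat //.
have : odd (c`_2^')%N by rewrite odd_2'nat part_pnat.
move: (c`_2^')%N => d d_odd; rewrite -modnMm (eqP m7) -modnXm.
have : odd (d %% 8) by rewrite odd_mod.
have := ltn_pmod d (isT : 0 < 8)%N; move: (d %% 8)%N.
by move=> [|[|[|[|[|[|[|[|//]]]]]]]].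
Qed.

End ThreeSquares.

(** * Counting factorials *)

Section FactorialStates.
Local Open Scope nat_scope.

Definition odd_double_fact (y : nat) : nat := \prod_(i < y) i.*2.+1.

Lemma fact_doubleE y : (y.*2)`! = 2 ^ y * y`! * odd_double_fact y.
Proof.
rewrite /odd_double_fact; elim: y => [|y IHy]; first by rewrite big_ord0.
rewrite doubleS !factS IHy big_ord_recr /= expnS.
have -> : y.*2.+2 = 2 * y.+1 by rewrite -doubleS mul2n.
by ring.
Qed.

Lemma fact_doubleS y : (y.*2.+1)`! = 2 ^ y * y`! * odd_double_fact y.+1.
Proof.
rewrite factS fact_doubleE /odd_double_fact big_ord_recr /=; ring.
Qed.

Lemma odd_odd_double_fact y : odd (odd_double_fact y).
Proof.
rewrite /odd_double_fact; elim: y => [|y IHy]; first by rewrite big_ord0.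
by rewrite big_ord_recr /= oddM IHy /= odd_double.
Qed.

(* The period is [4] because [1 * 3 * 5 * 7] is congruent to [1] modulo [8]. *)
Lemma odd_double_fact_mod8 y :
  odd_double_fact y = nth 1 [:: 1; 1; 3; 7] (y %% 4) %[mod 8].
Proof.
have per z : odd_double_fact (z + 4) = odd_double_fact z %[mod 8].
  rewrite /odd_double_fact !addnS addn0 !big_ord_recr /= -!mulnA.
  set a := \prod_(_ < _) _; rewrite -modnMmr.
  pose t := z * z + 4 * z.
  have -> : z.*2.+1 * (z.+1.*2.+1 * (z.+2.*2.+1 * z.+3.*2.+1)) =
            (2 * t * t + 11 * t + 13) * 8 + 1.
    by rewrite /t; lia.
  by rewrite modnMDl muln1.
have -> : y = y %% 4 + y %/ 4 * 4 by rewrite addnC -divn_eq.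
rewrite [in RHS]addnC modnMDl modn_mod; have : y %% 4 < 4 by rewrite ltn_pmod.
elim: (y %/ 4) => [|q IHq] lt4; last by rewrite mulSnr addnA per IHq.
move: (y %% 4) lt4; rewrite mul0n /odd_double_fact.
by do 4![case=> [|]; first by rewrite addn0 ?big_ord_recr ?big_ord0].
Qed.

(* The odd part modulo [8] is coded by its half, a number below [4]. *)
Definition fact_state (x : nat) : nat :=
  16 * odd (logn 2 x`!) + 4 * ((x`!)`_2^' %% 8)./2 + x %% 4.

(** The transition from [y] to [2 y + b]. It decodes [c %% 4] as [y] modulo 4, [(c %/ 4 %% 4).*2.+1]
    as the odd part modulo 8 and [c %/ 16] as the parity of the valuation, which grows by [y]. *)
Definition next_state (b : bool) (c : nat) : nat :=
  16 * (odd (c %% 4) (+) odd (c %/ 16))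
  + 4 * ((c %/ 4 %% 4).*2.+1 * nth 1 [:: 1; 1; 3; 7] ((c %% 4 + b) %% 4) %% 8)./2
  + ((c %% 4).*2 + b) %% 4.

Lemma fact_double_parts y (b : bool) :
  logn 2 (y.*2 + b)`! = y + logn 2 y`! /\
  ((y.*2 + b)`!)`_2^' = (y`!)`_2^' * odd_double_fact (y + b).
Proof.
have E : (y.*2 + b)`! = 2 ^ y * y`! * odd_double_fact (y + b).
  by case: b; rewrite ?addn0 ?addn1 ?fact_doubleE ?fact_doubleS.
have oddO := odd_odd_double_fact (y + b); have O_gt0 := odd_gt0 oddO.
have f_gt0 := fact_gt0 y; have p_gt0 : 0 < 2 ^ y by rewrite expn_gt0.
rewrite E; split.
  rewrite !lognM ?muln_gt0 ?p_gt0 // pfactorK //.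
  by rewrite [logn 2 (odd_double_fact _)]logn_coprime ?coprime2n // addn0.
rewrite !partnM ?muln_gt0 ?p_gt0 // [(2 ^ y)`__]part_p'nat ?mul1n; last first.
  by rewrite pnatNK pnatX.
by congr (_ * _); rewrite part_pnat_id // -odd_2'nat.
Qed.

Lemma fact_state_double y (b : bool) :
  fact_state (y.*2 + b) = next_state b (fact_state y).
Proof.
have [Ev Eu] := fact_double_parts y b; rewrite /fact_state Ev Eu.
have ou : odd ((y`!)`_2^' %% 8) by rewrite odd_mod // odd_2'nat part_pnat.
have lu : (y`!)`_2^' %% 8 < 8 by rewrite ltn_pmod.
rewrite -modnMml -modnMmr odd_double_fact_mod8 modnMmr oddD.
rewrite -(modnDml y b 4).
have -> : (y.*2 + b) %% 4 = ((y %% 4).*2 + b) %% 4.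
  by rewrite -!mul2n -modnDml -modnMmr modnDml.
have -> : odd y = odd (y %% 4) by rewrite odd_mod.
move: ((y`!)`_2^' %% 8) ou lu (y %% 4) (ltn_pmod y (isT : 0 < 4)) => u ou lu m lm.
move: (odd (logn 2 y`!)) => e.
clear Ev Eu; by case: u ou lu => [|[|[|[|[|[|[|[|//]]]]]]]] //= _ _;
   case: m lm => [|[|[|[|//]]]] _; case: e; case: b.
Qed.

Lemma fact_state0 : fact_state 0 = 0.
Proof. by rewrite /fact_state fact0 logn1 partn1. Qed.

Lemma fact_state1 : fact_state 1 = 1.
Proof. by rewrite (fact_state_double 0 true) fact_state0. Qed.

Lemma sum_double_range (F : nat -> nat) n :
  \sum_(0 <= x < n * 2) F x = \sum_(0 <= y < n) (F y.*2 + F (y.*2 + 1)).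
Proof.
elim: n => [|n IHn]; first by rewrite !big_geq.
by rewrite mulSn add2n !big_nat_recr //= IHn muln2 addn1 addnA.
Qed.

(** The transpose of the transition, acting on functions of the state by summing over one appended
    binary digit. *)
Definition extend_count (F : nat -> nat) (c : nat) : nat :=
  F (next_state false c) + F (next_state true c).

Lemma sum_fact_state F n k :
  \sum_(0 <= x < n * 2 ^ k) F (fact_state x) =
  \sum_(0 <= y < n) iter k extend_count F (fact_state y).
Proof.
elim: k n F => [|k IHk] n F; first by rewrite muln1.
rewrite expnS mulnA IHk sum_double_range; apply: eq_bigr => y _.
rewrite -[RHS]/(extend_count _ _) /extend_count.
by rewrite -(fact_state_double y true) -(fact_state_double y false) addn0.
Qed.

(** The codes with even valuation and half 3, that is odd part 7 modulo 8, for any [x] modulo 4. *)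
Definition nonrep_state (c : nat) : bool := 12 <= c < 16.

Lemma nonrep_stateE x :
  nonrep_state (fact_state x) =
  ~~ odd (logn 2 x`!) && ((x`!)`_2^' %% 8 == 7).
Proof.
rewrite /nonrep_state /fact_state.
have : odd ((x`!)`_2^' %% 8) by rewrite odd_mod // odd_2'nat part_pnat.
have := ltn_pmod ((x`!)`_2^') (isT : 0 < 8); have := ltn_pmod x (isT : 0 < 4).
move: (x %% 4) (((x`!)`_2^') %% 8) (odd (logn 2 x`!)) => m u e lm lu ou.
by case: u ou lu => [|[|[|[|[|[|[|[|//]]]]]]]] //= _ _;
   case: m lm => [|[|[|[|//]]]] _; case: e.
Qed.

End FactorialStates.

(** * Tables of deviations from the mean *)

Section StateTables.

Definition state_step (t : seq Z) : seq Z :=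
  [seq Z.add (nth Z0 t (next_state false c)) (nth Z0 t (next_state true c))
     | c <- iota 0 32].

(* Entry [c] is [8] times the number of good extensions of [c] by [k] bits, minus
   its mean value [2 ^ k]. *)
Definition state_table (k : nat) : seq Z :=
  iter k state_step [seq if nonrep_state c then Zpos 7 else Zneg 1 | c <- iota 0 32].

Lemma next_state_lt b c : (c < 32)%N -> (next_state b c < 32)%N.
Proof.
move=> ltc.
have /allP/(_ c) : all (fun c => next_state b c < 32)%N (iota 0 32) by case: b.
by rewrite mem_iota; apply.
Qed.

Lemma nth_state_tableS k c : (c < 32)%N ->
  nth Z0 (state_table k.+1) c =
  Z.add (nth Z0 (state_table k) (next_state false c))
        (nth Z0 (state_table k) (next_state true c)).
Proof.
move=> ltc; rewrite /state_table iterS {1}/state_step.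
by rewrite (nth_map 0%N) ?size_iota // nth_iota.
Qed.

Lemma state_tableE k c : (c < 32)%N ->
  Z.mul 8 (Z.of_nat (iter k extend_count nonrep_state c)) =
  Z.add (Z.pow 2 (Z.of_nat k)) (nth Z0 (state_table k) c).
Proof.
elim: k c => [|k IHk] c ltc.
  rewrite -[state_table 0]/[seq if nonrep_state c then Zpos 7 else Zneg 1
                            | c <- iota 0 32].
  rewrite (nth_map 0%N) ?size_iota // nth_iota // add0n.
  by rewrite /=; case: (nonrep_state c).
rewrite iterS /extend_count nth_state_tableS // Nat2Z.inj_add Z.mul_add_distr_l.
rewrite !IHk ?next_state_lt // Nat2Z.inj_succ Z.pow_succ_r; first by lia.
exact: Nat2Z.is_nonneg.
Qed.

(** Evaluated at [k = 5] for all 32 states and carried on by linearity; the factor is [2 ^ 12]. *)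
Lemma state_table_period k c : (5 <= k)%N -> (c < 32)%N ->
  nth Z0 (state_table (k + 24)) c = Z.mul 4096 (nth Z0 (state_table k) c).
Proof.
move=> /subnKC <-; elim: (k - 5)%N c => [|m IHm] c ltc.
  have -> : state_table (5 + 0 + 24) = map (Z.mul 4096) (state_table 5).
    by vm_compute.
  by rewrite (nth_map Z0) // size_map.
rewrite (addnS 5 m) addSn (@nth_state_tableS (5 + m + 24)) //.
rewrite (@nth_state_tableS (5 + m)) // !IHm ?next_state_lt //; lia.
Qed.

Lemma state_table_periods k j c : (5 <= k)%N -> (c < 32)%N ->
  nth Z0 (state_table (k + 24 * j)) c =
  Z.mul (Z.of_nat (2 ^ (12 * j))) (nth Z0 (state_table k) c).
Proof.
move=> k5 ltc; elim: j => [|j IHj]; first by rewrite muln0 addn0; lia.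
have -> : (k + 24 * j.+1 = k + 24 * j + 24)%N by lia.
rewrite state_table_period ?(leq_trans k5) ?leq_addr // IHj.
by rewrite mulnSr expnD Nat2Z.inj_mul [Z.of_nat (2 ^ 12)]/=; lia.
Qed.

Definition nonrep_count (n : nat) : nat :=
  (\sum_(0 <= x < n) nonrep_state (fact_state x))%N.

(* 0, 1 and 18 are the states of 0!, 1! and 2!. *)
Definition state_defect (k : nat) : Z :=
  let t := state_table k in
  Z.add (nth Z0 t 0) (Z.add (nth Z0 t 1) (nth Z0 t 18)).

(** The numbers below [3 * 2 ^ k] are 0, 1 and 2 extended by [k] binary digits. Compared with
    exponent [5 + i], the mean is multiplied by [a * a] and the deviation only by [a]. *)
Lemma nonrep_countE i j (k := (5 + i + 24 * j)%N)
    (a := Z.of_nat (2 ^ (12 * j))) :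
  Z.mul 8 (Z.of_nat (nonrep_count (3 * 2 ^ k))) =
  Z.add (Z.mul (Z.mul 3 (Z.pow 2 (Z.of_nat (5 + i)))) (Z.mul a a))
    (Z.mul a (state_defect (5 + i))).
Proof.
rewrite /state_defect /nonrep_count (sum_fact_state (fun c => nat_of_bool (nonrep_state c))).
have -> (F : nat -> nat) : (\sum_(0 <= y < 3) F y = F 0 + F 1 + F 2)%N.
  by rewrite !big_nat_recr //= big_geq.
rewrite fact_state0 fact_state1.
have -> : fact_state 2 = 18%N by rewrite (fact_state_double 1 false) fact_state1.
have Ek : Z.pow 2 (Z.of_nat k) = Z.mul (Z.pow 2 (Z.of_nat (5 + i))) (Z.mul a a).
  rewrite /k /a Nat2Z.inj_add Z.pow_add_r; [|exact: Nat2Z.is_nonneg..].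
  congr Z.mul; transitivity (Z.of_nat (2 ^ (24 * j))); first by lia.
  have -> : (2 ^ (24 * j) = 2 ^ (12 * j) * 2 ^ (12 * j))%N.
    by rewrite -expnD; congr expn; lia.
  by move: (2 ^ (12 * j))%N; lia.
have k5 : (5 <= 5 + i)%N by lia.
have H c : (c < 32)%N -> _ := fun lt => state_tableE k lt.
have := H 0%N isT; have := H 1%N isT; have := H 18%N isT.
rewrite /k !state_table_periods // -/k -/a Ek.
set x := iter _ _ _ 0%N; set y := iter _ _ _ 1%N; set z := iter _ _ _ 18%N.
move: (Z.pow 2 _) (nth _ _ 0%N) (nth _ _ 1%N) (nth _ _ 18%N) => p u v w.
by clearbody a x y z; clear; lia.
Qed.

(** The state 12, reached at 12, is fixed by appending the digit 0. This endpoint yields the term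
    [+ 1] of the formula. *)
Lemma fact_state_last k : (5 <= k)%N -> nonrep_state (fact_state (3 * 2 ^ k)).
Proof.
suff H m : fact_state (3 * 2 ^ (2 + m)) = 12%N.
  by move=> k5; rewrite (_ : k = 2 + (k - 2))%N ?H //; lia.
elim: m => [|m IHm].
  have -> : (3 * 2 ^ (2 + 0) = (3.*2 + false).*2 + false)%N by [].
  rewrite !fact_state_double.
  have -> : fact_state 3 = 23%N by rewrite (fact_state_double 1 true) fact_state1.
  by [].
have -> : (3 * 2 ^ (2 + m.+1) = (3 * 2 ^ (2 + m)).*2 + false)%N.
  by rewrite addnS expnS -mul2n addn0; lia.
by rewrite fact_state_double IHm.
Qed.

End StateTables.

(** One count runs over [1..n] and the other over [0..n-1]: the endpoint [n] is added, and 0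
    contributes nothing. *)
Lemma Sbar_count n : (0 < n)%N ->
  Sbar n = (nonrep_count n + nonrep_state (fact_state n))%N.
Proof.
move=> n_gt0; rewrite /Sbar -sum1dep_card big_mkcond /=.
transitivity (\sum_(i < n) nonrep_state (fact_state i.+1))%N.
  apply: eq_bigr => i _; rewrite nonrep_stateE.
  have E := legendre_three_squares (fact_gt0 i.+1).
  case: asboolP => [/E/negbTE ->//|H]; last first.
  by case: (_ && _) E H => // -[_ H] /(_ (H isT)).
rewrite -(big_mkord xpredT (fun i => nonrep_state (fact_state i.+1) : nat)).
by rewrite /nonrep_count -big_nat_recr //= [RHS]big_nat_recl // fact_state0.
Qed.

(** * The residue classes modulo 24 *)

Ltac solve_residue :=
  match goal with |- context [state_defect ?n] =>
    let v := eval vm_compute in (state_defect n) in change (state_defect n) with v;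
    let w := eval vm_compute in (Z.pow 2 (Z.of_nat n)) in
    change (Z.pow 2 (Z.of_nat n)) with w
  end;
  (* Clauses of other residue classes are vacuous; what remains is linear in [a], [a * a] and the
     count. *)
  move=> H; do 10?[split]; move=> //; move=> _;
  repeat match goal with |- context [((?m + ?i) %/ 2)%N] =>
    let v := eval vm_compute in ((m + i) %/ 2)%N in
    change ((m + i) %/ 2)%N with v
  end; lia.

Unset Implicit Arguments.

Theorem theorem4 (k : nat) (hk : (5 <= k)%N) :
  let r := (k %% 24)%N in
  let S := (Sbar (3 * 2 ^ k)%N)%:Z in
  let M : int := 3 * 2 ^+ (k - 3)%N + 1 in
  (r \in [:: 7; 9; 13; 18; 19]%N -> S = M) /\
  (r \in [:: 1; 3; 5]%N -> S = M - 2 ^+ ((k - 3) %/ 2)%N) /\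
  (r \in [:: 0; 4; 10]%N -> S = M - 2 ^+ ((k - 2) %/ 2)%N) /\
  (r \in [:: 2; 6; 8; 12]%N -> S = M - 2 ^+ ((k - 4) %/ 2)%N) /\
  (r \in [:: 11; 23]%N -> S = M - 2 ^+ ((k - 5) %/ 2)%N) /\
  (r = 14%N -> S = M + 2 ^+ ((k - 4) %/ 2)%N) /\
  (r = 15%N -> S = M + 2 ^+ ((k - 1) %/ 2)%N) /\
  (r = 16%N -> S = M + 3 * 2 ^+ ((k - 4) %/ 2)%N) /\
  (r = 17%N -> S = M + 2 ^+ ((k - 3) %/ 2)%N) /\
  (r \in [:: 20; 22]%N -> S = M - 3 * 2 ^+ ((k - 4) %/ 2)%N) /\
  (r = 21%N -> S = M - 2 ^+ ((k - 1) %/ 2)%N).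
Proof.
(* The periodicity of the tables is available from [k = 5] on, so [k - 5] is divided by 24. *)
pose i := ((k - 5) %% 24)%N; pose j := ((k - 5) %/ 24)%N.
have Ek : k = (5 + i + 24 * j)%N by rewrite /i /j; lia.
have lti : (i < 24)%N by rewrite ltn_pmod.
move=> r S M.
have Er : r = ((5 + i) %% 24)%N by rewrite /r Ek addnC mulnC modnMDl.
have ES : S = (nonrep_count (3 * 2 ^ k))%:Z + 1.
  by rewrite /S Sbar_count ?fact_state_last ?muln_gt0 ?expn_gt0 // addn1 intS addrC.
have Epow t : (t <= 5)%N ->
    2 ^+ ((k - t) %/ 2)%N = 2 ^+ ((5 - t + i) %/ 2)%N * (2 ^ (12 * j))%N%:Z :> int.
  move=> t5; have -> : ((k - t) %/ 2 = (5 - t + i) %/ 2 + 12 * j)%N.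
    by rewrite Ek; lia.
  by rewrite exprD -[(2 ^ _)%N%:Z]natz natrX.
have EM : M = 3 * (2 ^+ (2 + i)%N * ((2 ^ (12 * j))%N%:Z * (2 ^ (12 * j))%N%:Z)) + 1.
  rewrite /M; congr (_ * _ + _).
  have -> : (k - 3 = (2 + i) + (12 * j + 12 * j))%N by rewrite Ek; lia.
  by rewrite exprD [2 ^+ (12 * j + _)]exprD -[(2 ^ _)%N%:Z]natz natrX.
have := nonrep_countE i j; cbv zeta; rewrite -Ek.
rewrite ES EM Er !Epow //.
move: (2 ^ (12 * j))%N (nonrep_count _) => a T; clearbody i; clear -lti; move: i lti.
by do 24![case=> [_|]; first by solve_residue].
Qed.
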